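(* Let $G_m$ be a bounded Vilenkin group and let $f\in L_1(G_m\times G_m)$. Then $$\lim_{n\to\infty}W_n(x,y;f)=0\qquad\text{for a.e. }(x,y)\in G_m\times G_m,$$ that is, almost every point is a Marcinkiewicz-Lebesgue point of $f$.
   Context: Let $\mathbb N=\{0,1,2,\dots\}$ and let $m=(m_0,m_1,\dots)$ be a bounded sequence of integers $m_k\ge 2$. $Z_{m_k}=\{0,1,\dots,m_k-1\}$ is the additive group of integers modulo $m_k$, and $G_m=\prod_{k} Z_{m_k}$ is the complete direct product (product of discrete topologies), with coordinatewise addition modulo $m_k$ (the inverse operation is denoted $-$), elements $x=(x_0,x_1,\dots)$, $x_k\in Z_{m_k}$. Since $m$ is bounded, $G_m$ is called a bounded Vilenkin group. $\mu$ is the normalized Haar measure (the product of the uniform probability measures on $Z_{m_k}$); the product measure on $G_m\times G_m$ is also denoted $\mu$. Put $I_0(x)=G_m$, $I_n(x)=\{y\in G_m: y_0=x_0,\dots,y_{n-1}=x_{n-1}\}$, $I_n=I_n(0)$. Let $e_n\in G_m$ have $n$-th coordinate $1$ and all other coordinates $0$; for an integer $a$ with $0\le a\le m_n-1$, $a e_n$ is the element with $n$-th coordinate $a$ and other coordinates $0$. Let $M_0=1$, $M_{k+1}=m_kM_k$. Every $n\in\mathbb N$ is uniquely $n=\sum_{j\ge0} n_jM_j$ with $n_j\in Z_{m_j}$. Vilenkin functions: $r_k(x)=\exp(2\pi \imath x_k/m_k)$ with $\imath^2=-1$, and $\psi_n(x)=\prod_{k\ge0} r_k(x)^{n_k}$.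 For $i\le n$ let $r_{i,n}(x,y)=\prod_{l=i}^{n}\Big(\sum_{s=0}^{m_l-1}\psi_{M_l}(x+y)^s\Big)$, which equals $m_im_{i+1}\cdots m_n$ if $x_l+y_l\equiv 0 \pmod{m_l}$ for all $l=i,\dots,n$, and $0$ otherwise; an empty product ($i>n$) equals $1$. For $j\in\mathbb N$ define, with $\Delta(t,u)=|f(x-t,y-u)-f(x,y)|$, $$\begin{aligned}W_j(x,y;f)=\;&M_j^{-1}\sum_{q=0}^{j-1}\sum_{k=q}^{j-1}\sum_{a=1}^{m_q-1}M_qM_k^2\int_{I_k\times I_k(a e_q)}\Delta(t,u)\,r_{k+1,j-1}(t,u)\,d\mu(t,u)\\&+M_j^{-1}\sum_{q=0}^{j-1}\sum_{k=q}^{j-1}\sum_{a=1}^{m_q-1}M_qM_k^2\int_{I_k(a e_q)\times I_k}\Delta(t,u)\,r_{k+1,j-1}(t,u)\,d\mu(t,u)\\&+\sum_{s=0}^{j}\sum_{i=s}^{j}M_sM_i\sum_{a=1}^{m_s-1}\int_{I_j\times I_i(a e_s)}\Delta(t,u)\,d\mu(t,u)\\&+\sum_{s=0}^{j}\sum_{i=s}^{j}M_sM_i\sum_{a=1}^{m_s-1}\int_{I_i(a e_s)\times I_j}\Delta(t,u)\,d\mu(t,u).\end{aligned}$$ A point $(x,y)\in G_m\times G_m$ is a Marcinkiewicz-Lebesgue point of $f\in L_1(G_m\times G_m)$ if $\lim_{n\to\infty}W_n(x,y;f)=0$. *)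

(* Defs.v *)
From HB Require Import structures.
From mathcomp Require Import all_boot all_order all_algebra complex.
From mathcomp Require Import all_classical all_reals all_analysis.

Set Implicit Arguments.
Unset Strict Implicit.
Unset Printing Implicit Defensive.

Import Order.TTheory GRing.Theory Num.Theory.
Import numFieldNormedType.Exports.

Local Open Scope classical_set_scope.
Local Open Scope ring_scope.
Local Open Scope complex_scope.

(* 'Z_n is Z/nZ only for n >= 2: every use of vilenkin m needs the hypothesis
   forall k, 2 <= m k. *)
Definition vilenkin (m : nat -> nat) := forall k : nat, 'Z_(m k).

Section vilenkin_group.
Variable m : nat -> nat.

Definition vadd (x y : vilenkin m) : vilenkin m := fun k => x k + y k.
Definition vopp (x : vilenkin m) : vilenkin m := fun k => - x k.
Definition vzero : vilenkin m := fun=> 0.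

Lemma vaddA : associative vadd.
Proof. by move=> x y z; apply: functional_extensionality_dep => k; exact: addrA. Qed.
Lemma vaddC : commutative vadd.
Proof. by move=> x y; apply: functional_extensionality_dep => k; exact: addrC. Qed.
Lemma vadd0 : left_id vzero vadd.
Proof. by move=> x; apply: functional_extensionality_dep => k; exact: add0r. Qed.
Lemma vaddN : left_inverse vzero vopp vadd.
Proof. by move=> x; apply: functional_extensionality_dep => k; exact: addNr. Qed.

HB.instance Definition _ := gen_eqMixin (vilenkin m).
HB.instance Definition _ := gen_choiceMixin (vilenkin m).
HB.instance Definition _ := isPointed.Build (vilenkin m) vzero.
HB.instance Definition _ :=
  GRing.isZmodule.Build (vilenkin m) vaddA vaddC vadd0 vaddN.

(* Generates the product of the discrete sigma-algebras, which is also the Borel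
   sigma-algebra of the product topology. *)
Definition coordinate_cylinders : set (set (vilenkin m)) :=
  [set A | exists k (a : 'Z_(m k)), A = [set x : vilenkin m | x k = a]].

HB.instance Definition _ := Measurable.copy (vilenkin m)
  (g_sigma_algebraType coordinate_cylinders).

(* a e_n, for 0 <= a < m_n *)
Definition single (n a : nat) : vilenkin m :=
  fun k => if k == n then a%:R else 0.

Definition cylinder (n : nat) (x : vilenkin m) : set (vilenkin m) :=
  [set y | forall k, (k < n)%N -> y k = x k].

Definition radix (n : nat) : nat := \prod_(k < n) m k.

Definition digit (n k : nat) : nat := (n %/ radix k) %% m k.

End vilenkin_group.

(* The product of the uniform probability measures, i.e. the normalized Haar
   measure; it is unique since the sets below form a generating pi-system, and
   it exists by normalized_haar_exists. *)
Definition normalized_haar (R : realType) (m : nat -> nat)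
    (mu : set (vilenkin m) -> \bar R) :=
  forall (n : nat) (A : forall k, {set 'Z_(m k)}),
    mu [set x | forall k, (k < n)%N -> x k \in A k] =
    (\prod_(k < n) (#|A k|%:R / (m k)%:R))%:E.

Section normalized_haar_exists.
Variables (R : realType) (m : nat -> nat).
Hypothesis m_ge2 : forall k, (2 <= m k)%N.
Implicit Types (x : R) (A : forall k, {set 'Z_(m k)}) (Q : pred nat).

(* Existence: push the uniform law of [0, 1] forward by digit expansion. *)
Let trunc n x := Num.truncn (x * (radix m n)%:R).
(* The digits of a real number of [0, 1[ in the mixed radix m. *)
Let expansion x : vilenkin m := fun k => (trunc k.+1 x)%:R.
Let good A := fix good n c {struct n} :=
  if n is n'.+1 then good n' (c %/ m n')%N && (c%:R \in A n') else true.

Let m_gt0 k : (0 < m k)%N. Proof. exact: leq_trans (m_ge2 k). Qed.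
Let radixS n : radix m n.+1 = (radix m n * m n)%N.
Proof. by rewrite /radix big_ord_recr. Qed.
Let radix_gt0 n : (0 < radix m n)%N. Proof. exact: prodn_gt0. Qed.

Let truncS n x : (trunc n.+1 x %/ m n)%N = trunc n x.
Proof.
suff h c : (trunc n.+1 x %/ m n <= c)%N = (trunc n x <= c)%N.
  by apply/eqP; rewrite eqn_leq h leqnn -h leqnn.
have cm : (0 < c.+1 * m n)%N by rewrite muln_gt0 m_gt0.
rewrite -ltnS ltn_divLR// -(prednK cm) ltnS.
rewrite /trunc !truncn_le_nat (prednK cm) radixS !natrM mulrA.
by rewrite ltr_pM2r// ltr0n.
Qed.

Let expansion_good A n x :
  (forall k, (k < n)%N -> expansion x k \in A k) <-> good A n (trunc n x).
Proof.
elim: n => [|n IH]; first by split.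
rewrite /= truncS; split=> [h|/andP[/IH h hn] k].
  by apply/andP; split; [apply/IH => k kn; apply: h; exact: ltnW|exact: h].
by rewrite ltnS leq_eqVlt => /orP[/eqP ->//|]; exact: h.
Qed.

Let count_good A n :
  (\sum_(0 <= c < radix m n) good A n c = \prod_(k < n) #|A k|)%N.
Proof.
elim: n => [|n IH]; first by rewrite /radix !big_ord0 big_nat1.
rewrite radixS big_nat_mul big_ord_recr -IH /= big_distrl /=.
apply: eq_bigr => q _; rewrite -{1}[(q * m n)%N]add0n mulSn big_addn addnK.
under eq_big_nat => a /andP[_ am].
  rewrite divnDMl// divn_small// add0n.
  rewrite natrD natrM [(m n)%:R](_ : _ = 0 :> 'Z_(m n)) ?mulr0 ?addr0; last first.
    exact: pchar_Zp.
  rewrite -mulnb; over.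
rewrite -big_distrr /=; congr (_ * _)%N.
have ZpE (h : nat -> nat) :
    (\sum_(a < m n) h a = \sum_(a < (Zp_trunc (m n)).+2) h a)%N.
  by rewrite Zp_cast.
rewrite -sum1_card big_mkord (ZpE (fun a => (a%:R : 'Z_(m n)) \in A n : nat)).
rewrite [RHS]big_mkcond /=; apply: eq_bigr => a _.
by rewrite Zp_nat valZpK; case: (a \in A n).
Qed.

Let F n c : set R := `[c%:R / (radix m n)%:R, c.+1%:R / (radix m n)%:R[.

Let r0 n : 0 < (radix m n)%:R :> R. Proof. by rewrite ltr0n. Qed.

Let trunc_eq n c x : 0 <= x -> F n c x <-> trunc n x = c.
Proof.
move=> x0; have y0 : 0 <= x * (radix m n)%:R by rewrite mulr_ge0// ltW.
rewrite /F /= in_itv /= ler_pdivrMr// ltr_pdivlMr// -truncn_eq//.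
by split => /eqP.
Qed.

Let F_ge0 n c x : F n c x -> 0 <= x.
Proof.
by rewrite /F /= in_itv /= => /andP[+ _]; apply: le_trans; rewrite divr_ge0.
Qed.

Let measurable_trunc Q n : measurable [set x | Q (trunc n x)].
Proof.
have le c : measurable [set x | (trunc n x <= c)%N].
  have -> : [set x | (trunc n x <= c)%N] = `]-oo, c.+1%:R / (radix m n)%:R[%classic.
    apply/seteqP; split => x /=; rewrite in_itv /= /trunc truncn_le_nat;
    by rewrite ltr_pdivlMr.
  exact: measurable_itv.
have -> : [set x | Q (trunc n x)] =
    \bigcup_(c in [set c | Q c]) ([set x | (trunc n x <= c)%N] `&`
       ~` \bigcup_(b in [set b | (b < c)%N]) [set x | (trunc n x <= b)%N]).
  apply/seteqP; split => [x /= Qx|x [c /= Qc [xc nxc]]].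
    exists (trunc n x) => //; split => //= -[b /= bx].
    by rewrite leqNgt bx.
  suff <- : c = trunc n x by [].
  apply/eqP; rewrite eqn_leq xc andbT leqNgt; apply/negP => lt.
  by apply: nxc; exists (trunc n x) => /=.
apply: bigcup_measurable => c _; apply: measurableI => //.
by apply: measurableC; apply: bigcup_measurable.
Qed.

Let lebesgue_trunc Q n :
  @lebesgue_measure R ([set x | Q (trunc n x)] `&` `[0, 1[%classic) =
  ((\sum_(0 <= c < radix m n) Q c)%N%:R / (radix m n)%:R)%:E.
Proof.
have -> : [set x | Q (trunc n x)] `&` `[0, 1[%classic =
    \big[setU/set0]_(c < radix m n | Q c) F n c.
  rewrite big_mkcond -(bigcup_mkord _ (fun c => if Q c then F n c else set0)).
  apply/seteqP; split => [x [/= Qx]|x [c /= cm]].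
    rewrite in_itv /= => /andP[x0 x1]; exists (trunc n x) => /=.
      by rewrite /trunc truncn_lt_nat ?mulr_ge0// gtr_pMl.
    by rewrite Qx; apply/trunc_eq.
  case: ifP => // Qc Fc; have x0 := F_ge0 Fc.
  have /(trunc_eq _ _ x0) xc := Fc; rewrite xc; split => //.
  rewrite in_itv /= x0 -(@ltr_pM2r _ _ (r0 n)) mul1r -truncn_lt_nat.
    by rewrite -/(trunc n x) xc.
  by rewrite mulr_ge0// ltW.
rewrite (@measure_bigsetU_ord _ R _ lebesgue_measure _ (fun i => Q i) (fun i => F n i)).
- rewrite big_mkcond big_mkord natr_sum mulr_suml -sumEFin.
  apply: eq_bigr => c _; case: (Q c); last by rewrite mul0r.
  rewrite /F /= lebesgue_measure_itv/= lte_fin ltr_pM2r ?invr_gt0//.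
  by rewrite ltr_nat ltnSn -EFinB -mulrBl -natrB// subSnn.
- by move=> i; exact: measurable_itv.
- move=> i j _ _ [x [Fi Fj]]; have x0 := F_ge0 Fi.
  by apply: val_inj; rewrite /= -((trunc_eq _ _ x0).1 Fi) ((trunc_eq _ _ x0).1 Fj).
Qed.

Lemma normalized_haar_exists :
  exists mu : probability (vilenkin m) R, normalized_haar mu.
Proof.
have mexp : @measurable_fun _ _ (measurableTypeR R) (vilenkin m) setT expansion.
  apply: (@measurability _ _ (measurableTypeR R) (vilenkin m) setT expansion
    (@coordinate_cylinders m) erefl) => _ [_ [k [a ->]] <-].
  rewrite setTI.
  rewrite [X in measurable X](_ : _ =
      [set x | (fun c => (c%:R : 'Z_(m k)) == a) (trunc k.+1 x)]).
    exact: (measurable_trunc (fun c => (c%:R : 'Z_(m k)) == a) k.+1).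
  by apply/seteqP; split => x /= /eqP.
pose P : probability _ R := uniform_prob (ltr01 : 0 < 1 :> R).
pose X : {mfun measurableTypeR R >-> vilenkin m} :=
  @mfun_Sub _ _ (measurableTypeR R) (vilenkin m) expansion (mem_set mexp).
exists (distribution P X) => n A.
rewrite /distribution /pushforward.
rewrite /= [X in uniform_prob _ X](_ : _ = [set x | good A n (trunc n x)]); last first.
  by apply/seteqP; split => x /expansion_good.
set U := [set x | _]; have mU : measurable U by exact: measurable_trunc.
transitivity (@lebesgue_measure R (U `&` `[0, 1[%classic)).
  have m1 : measurable (`[0, 1[%classic : set R) by exact: measurable_itv.
  rewrite /uniform_prob integral_uniform_pdf.
  have -> : U `&` `[0, 1]%classic = (U `&` `[0, 1[%classic) `|` (U `&` [set 1]).
    rewrite -setIUr; congr (_ `&` _); apply/seteqP; split => x /=.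
      rewrite !in_itv /= => /andP[-> /=]; rewrite le_eqVlt => /orP[/eqP|]; tauto.
    by rewrite !in_itv /= => -[/andP[-> /ltW //]|->]; rewrite ler01 lexx.
  rewrite (eq_integral (cst 1%E)) => [|x]; last first.
    rewrite inE /uniform_pdf /= in_itv /= => -[[_ /andP[-> /ltW ->]]|[_ ->]].
      by rewrite subr0 invr1.
    by rewrite ler01 lexx subr0 invr1.
  rewrite integral_cst ?mul1e; last first.
    by apply: measurableU; apply: measurableI.
  rewrite measureU0//; [exact: measurableI|exact: measurableI|].
  apply: (@subset_measure0 _ _ _ lebesgue_measure _ [set 1]) => //.
  - exact: measurableI.
  - exact: lebesgue_measure_set1.
by rewrite lebesgue_trunc count_good prodf_div /radix !natr_prod.
Qed.

End normalized_haar_exists.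

Section complex_integral.
Context d (T : measurableType d) (R : realType).
Variable mu : {measure set T -> \bar R}.

Definition cintegrable (f : T -> R[i]) :=
  mu.-integrable setT (fun z => (complex.Re (f z))%:E) /\
  mu.-integrable setT (fun z => (complex.Im (f z))%:E).

Definition cintegral (D : set T) (g : T -> R[i]) : R[i] :=
  (\int[mu]_(z in D) complex.Re (g z)) +i* (\int[mu]_(z in D) complex.Im (g z)).

End complex_integral.

Section marcinkiewicz.
Variables (R : realType) (m : nat -> nat).
Local Notation G := (vilenkin m).
Local Notation M n := ((radix m n)%:R : R[i]).

Definition rademacher (k : nat) (x : G) : R[i] :=
  let theta : R := 2 * pi * (x k : nat)%:R / (m k)%:R in
  cos theta +i* sin theta.

(* The digits of n of index k >= n vanish, because radix m k >= 2 ^ k. *)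
Definition psi (n : nat) (x : G) : R[i] :=
  \prod_(k < n) rademacher k x ^+ digit m n k.

Definition rprod (i n : nat) (p : G * G) : R[i] :=
  \prod_(i <= l < n.+1) \sum_(s < m l) psi (radix m l) (p.1 + p.2) ^+ s.

Definition increment (f : G * G -> R[i]) (z p : G * G) : R[i] :=
  `|f (z.1 - p.1, z.2 - p.2) - f z|.

(* j.-1 is only reached for j > 0: the sums that contain it are empty at j = 0. *)
Definition W (mu : probability G R) (f : G * G -> R[i]) (j : nat) (z : G * G) :
    R[i] :=
  let P := (mu \x mu)%E in
  let I n := cylinder n (0 : G) in
  let J n a q := cylinder n (single m q a) in
  (M j)^-1 * (\sum_(0 <= q < j) \sum_(q <= k < j) \sum_(1 <= a < m q)
    M q * M k ^+ 2 *
    cintegral P (I k `*` J k a q)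
      (fun p => increment f z p * rprod k.+1 j.-1 p)) +
  (M j)^-1 * (\sum_(0 <= q < j) \sum_(q <= k < j) \sum_(1 <= a < m q)
    M q * M k ^+ 2 *
    cintegral P (J k a q `*` I k)
      (fun p => increment f z p * rprod k.+1 j.-1 p)) +
  \sum_(0 <= s < j.+1) \sum_(s <= i < j.+1) M s * M i *
    \sum_(1 <= a < m s) cintegral P (I j `*` J i a s) (increment f z) +
  \sum_(0 <= s < j.+1) \sum_(s <= i < j.+1) M s * M i *
    \sum_(1 <= a < m s) cintegral P (J i a s `*` I j) (increment f z).

(* The regular module R[i]^o carries the topology of the norm of R[i]. *)
Definition marcinkiewicz_lebesgue_point (mu : probability G R)
    (f : G * G -> R[i]) (z : G * G) :=
  (W mu f n z : R[i]^o) @[n --> \oo] --> (0 : R[i]^o).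

End marcinkiewicz.

(* Main.v *)
Require Import Defs.
From mathcomp Require Import all_boot all_order all_algebra complex.
From mathcomp Require Import all_classical all_reals all_analysis.
From mathcomp Require Import measurable_realfun ring lra.
Import Order.TTheory GRing.Theory Num.Theory.
Import numFieldNormedType.Exports.
Local Open Scope classical_set_scope.
Local Open Scope ring_scope.

Set Implicit Arguments.
Unset Strict Implicit.
Unset Printing Implicit Defensive.

(** W_j f (x, y) is a weighted sum of means of the increments
p |-> |f (z - p) - f z| at z = (x, y), so the plan is the one of Lebesgue's
differentiation theorem: the claim holds for functions of finitely many
coordinates, these are dense in L1, and a maximal inequality of weak type (1,1)
controls the error.

Every summand of W_j is, up to a constant, M_q / M_j times the mean of the
increments over a translate of a subgroup H of G x G.  Either H is a rectangle
I_j x I_k, or it is the set of the (t, u) in I_k x I_k with t_l + u_l = 0 for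
k < l < j, which is the support of the product r_(k+1,j-1) ([rprodE]).  In both
cases H contains I_j x I_j, and H and the translation by a e_q lie in I_q x I_q,
where q <= k <= j.  The bounds of [measure_antidiag] and [weight_carrier] show
that the weights are those of means, and [W_le] bounds W by the sum over q of
(j + 1 - q) M_q / M_j <= (j + 1 - q) 2 ^ -(j - q) times the largest mean.

Fix the spread n = j - q, the distance j - k, the type of H and the multiple a.
Over j in one class modulo n + 1, the subgroups H are nested and each translation
belongs to the previous subgroup.  For such a sequence the maximal function is of
weak type (1,1) with constant 2 ([weak_type_nested]): the translation moves only
the part of each level set that was not selected at an earlier step.  Hence the
maximal function over all j is of weak type with constant 2 (n + 1)
([weak_type_spread]), and there are O(n + 1) of them for each n.

This polynomial growth in n is harmless.  Cut the n-th family at the height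
lam (3/2)^n: the measures of the level sets are summable in n and add up to
O(|h|_1 / lam) ([measure_exceptional]), while off all of them the weighted means
sum to O(lam) since the weights are of order (n + 1) 2 ^ -n ([W_exceptional]).

Finally write the increments of f as at most h (z - p) + h z plus the increments
of an approximant of f that depends on the coordinates of index less than N
([oscillation_decomposition]).  The latter vanish for p in I_N x I_N, so they
contribute only for q < N, with weights that tend to 0 as j grows.  With
|h|_1 <= 4 ^ -k and lam = 2 ^ -k for k = 0, 1, 2, ..., the Borel-Cantelli lemma
shows that almost every z is outside all but finitely many exceptional sets. *)

(** * Measurability and invariance of the Haar measure *)

Section group_measurability.
Variable m : nat -> nat.
Local Notation G := (vilenkin m).
Local Notation T := (G * G)%type.

Lemma measurable_coord k (a : 'Z_(m k)) : measurable [set x : G | x k = a].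
Proof. by apply: sub_sigma_algebra; exists k, a. Qed.

Lemma measurable_coord_pred k (Q : pred 'Z_(m k)) :
  measurable [set x : G | Q (x k)].
Proof.
rewrite (_ : [set _ | _] = \bigcup_(a in [set` Q]) [set x : G | x k = a]).
  by apply: fin_bigcup_measurable => // a _; exact: measurable_coord.
by apply/seteqP; split => [x Qx|x [a Qa /= ->]//]; exists (x k).
Qed.

Lemma measurable_fun_vilenkin d (S : measurableType d) (D : set S) (h : S -> G) :
  (forall k a, measurable (D `&` [set s | h s k = a])) -> measurable_fun D h.
Proof.
move=> mh mD; apply: (@measurability _ _ _ _ D h (@coordinate_cylinders m) erefl) => //.
by move=> _ [_ [k [a ->]] <-]; exact: mh.
Qed.

(** A level set of a coordinate of x - y is a finite union of rectangles, because
each coordinate takes finitely many values.  Joint measurability, rather than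
measurability in each variable, is what Fubini's theorem asks for. *)
Lemma measurable_vilenkin_sub : measurable_fun setT (fun p : T => p.1 - p.2).
Proof.
apply: measurable_fun_vilenkin => k a; rewrite setTI.
rewrite (_ : [set _ | _] = \bigcup_(b in [set: 'Z_(m k)])
    ([set x : G | x k = a + b] `*` [set x : G | x k = b])).
  apply: fin_bigcup_measurable => // b _.
  by apply: measurableX; exact: measurable_coord.
apply/seteqP; split => [[x y] /= xy|[x y] [b _ /= [xa yb]]].
  exists (y k) => //=; split => //.
  by rewrite -xy; apply/esym/subrK.
by transitivity (x k - y k) => //; rewrite xa yb addrK.
Qed.

Lemma measurable_fun_subT d (S : measurableType d) (g h : S -> T) :
  measurable_fun setT g -> measurable_fun setT h ->
  measurable_fun setT (fun s => g s - h s).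
Proof.
move=> mg mh; apply: measurable_fun_pair => /=.
- apply: (measurableT_comp measurable_vilenkin_sub (g := fun s => ((g s).1, (h s).1))).
  by apply: measurable_fun_pair; exact: measurableT_comp.
- apply: (measurableT_comp measurable_vilenkin_sub (g := fun s => ((g s).2, (h s).2))).
  by apply: measurable_fun_pair; exact: measurableT_comp.
Qed.

Lemma measurable_fun_addT (c : T) : measurable_fun setT (fun z : T => z + c).
Proof.
have := measurable_fun_subT (@measurable_id _ T setT) (measurable_cst (- c)).
by under eq_fun do rewrite opprK.
Qed.

End group_measurability.

Section haar_translation.
Variables (R : realType) (m : nat -> nat).
Hypothesis m_ge2 : forall k, (2 <= m k)%N.
Local Notation G := (vilenkin m).
Local Notation T := (G * G)%type.
Variable mu : probability G R.
Hypothesis mu_haar : normalized_haar mu.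
Local Notation P := (mu \x mu)%E.

Lemma measurable_vilenkin_add (c : G) : measurable_fun setT (fun x : G => x + c).
Proof.
apply: measurable_fun_vilenkin => k a; rewrite setTI.
rewrite (_ : [set _ | _] = [set x : G | x k = a - c k]).
  exact: measurable_coord.
apply/seteqP; split => x /= xc; first by rewrite -xc; apply/esym/addrK.
by change (x k + c k = a); rewrite xc subrK.
Qed.

Let box n (A : forall k, {set 'Z_(m k)}) : set G :=
  [set x | forall k, (k < n)%N -> x k \in A k].

Let measurable_box n A : measurable (box n A).
Proof.
rewrite (_ : box n A = \bigcap_(k in `I_n) [set x : G | x k \in A k]).
  apply: fin_bigcap_measurable => // k _; exact: (measurable_coord_pred (mem (A k))).
by apply/seteqP; split => x /= xA k kn; exact: xA.
Qed.

(** The boxes form a pi-system that generates the sigma-algebra, and the Haar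
measure of a box depends only on the cardinals of its sides, which translations
preserve. *)
Lemma haar_translate (c : G) (A : set G) :
  measurable A -> mu [set x | A (x + c)] = mu A.
Proof.
pose g : {mfun G >-> G} := @mfun_Sub _ _ _ _ _ (mem_set (measurable_vilenkin_add c)).
pose C : set (set G) := [set B | exists n A, B = box n A].
move=> mA; apply/esym.
rewrite -[RHS]/(distribution mu g A).
apply: (measure_unique C (fun=> setT)) => //.
- rewrite eqEsubset; split.
    apply: smallest_sub; first exact: smallest_sigma_algebra.
    move=> _ [k [a ->]]; apply: sub_sigma_algebra.
    exists k.+1, (fun i => [set x : 'Z_(m i) | (i == k) ==> (x == inZp (a : nat))]%SET).
    apply/seteqP; split => x /=.
      move=> xa i; rewrite ltnS leq_eqVlt inE => /orP[/eqP ->|ik].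
        by rewrite eqxx xa /= valZpK.
      by rewrite (ltn_eqF ik).
    by move=> /(_ k (ltnSn k)); rewrite inE eqxx /= valZpK => /eqP.
  apply: smallest_sub; first exact: sigma_algebra_measurable.
  by move=> _ [n [B ->]]; exact: measurable_box.
- move=> _ _ [n1 [A1 ->]] [n2 [A2 ->]].
  exists (maxn n1 n2), (fun k => (if (k < n1)%N then A1 k else [set: _]%SET) :&:
     (if (k < n2)%N then A2 k else [set: _]%SET))%SET.
  apply/seteqP; split => x /=.
    move=> [x1 x2] k kn; rewrite inE; apply/andP; split.
      by case: ifP => [/x1//|_]; rewrite inE.
    by case: ifP => [/x2//|_]; rewrite inE.
  move=> x12; split => k kn.
    by have := x12 k; rewrite leq_max kn inE => /(_ isT)/andP[].
  by have := x12 k; rewrite leq_max kn orbT inE => /(_ isT)/andP[].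
- by move=> n; exists 0%N, (fun=> finset.set0); apply/seteqP; split.
- by apply/seteqP; split => // x _; exists 0%N.
- move=> _ [n [B ->]].
  transitivity (mu (box n (fun k => [set a : 'Z_(m k) | (a + c k) \in B k]%SET)));
    last first.
    congr (mu _); apply/seteqP; split => x /= xB k kn; have := xB k kn;
      by rewrite inE.
  rewrite [LHS]mu_haar [RHS]mu_haar; congr (_%:E); apply: eq_bigr => k _; congr (_%:R / _).
  rewrite -[RHS](card_imset _ (addIr (c k))); apply: eq_card => a.
  apply/idP/imsetP => [aB|[b bB ->]]; last by move: bB; rewrite inE.
  by exists (a - c k); rewrite ?inE subrK.
- by move=> k; apply: (le_lt_trans (probability_le1 _ measurableT) (ltry 1)).
Qed.

Lemma haar2_translate (c : T) (A : set T) :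
  measurable A -> P [set z | A (z + c)] = P A.
Proof.
move=> mA.
pose g : {mfun T >-> T} := @mfun_Sub _ _ _ _ _ (mem_set (measurable_fun_addT c)).
rewrite -[LHS]/(distribution P g A); apply/esym.
apply: product_measure_unique => // B C mB mC.
rewrite /distribution /pushforward /=.
rewrite (_ : _ @^-1` _ = [set x | B (x + c.1)] `*` [set x | C (x + c.2)])//.
have mpre (b : G) D : measurable D -> measurable [set x | D (x + b)].
  by move=> /(measurable_vilenkin_add b measurableT); rewrite setTI.
rewrite product_measure1E//; [|exact: mpre|exact: mpre].
congr (_ * _)%E; [exact: (haar_translate c.1 mB)|exact: (haar_translate c.2 mC)].
Qed.

End haar_translation.

(** * Convolution with indicators on the squared group *)

Section convolution.
Variables (R : realType) (m : nat -> nat).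
Local Notation G := (vilenkin m).
Local Notation T := (G * G)%type.
Variable P : probability T R.
Hypothesis P_translate : forall (c : T) (A : set T),
  measurable A -> P [set z | A (z + c)] = P A.
Implicit Types (A H F : set T) (h : T -> \bar R) (c z : T).
Local Open Scope ereal_scope.

Lemma measurable_translate c A : measurable A -> measurable [set z | A (z + c)%R].
Proof. by move=> /(measurable_fun_addT c measurableT); rewrite setTI. Qed.

Lemma integral_translate c h :
  measurable_fun setT h -> (forall z, 0 <= h z) ->
  \int[P]_z h (z + c)%R = \int[P]_z h z.
Proof.
move=> mh h0.
pose g : {mfun T >-> T} := @mfun_Sub _ _ _ _ _ (mem_set (measurable_fun_addT c)).
have := @ge0_integral_pushforward _ _ _ _ _ g (measurable_fun_addT c) P setT h
  measurableT mh (fun z _ => h0 z).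
rewrite preimage_setT => <-.
by apply: eq_measure_integral => A mA _; exact: P_translate.
Qed.

(** The convolution of h with the indicator function of A.  It is not divided by
P A: the weights in W carry their own normalization. *)
Definition convol A h z := \int[P]_(p in A) h (z - p)%R.

Lemma integral_indicM A h : \int[P]_(p in A) h p = \int[P]_p ((\1_A p)%:E * h p).
Proof.
rewrite integral_mkcond; apply: eq_integral => p _.
by rewrite patchE indicE; case: ifPn => _; rewrite ?mul1e ?mul0e.
Qed.

Lemma convol_ge0 A h z : (forall z, 0 <= h z) -> 0 <= convol A h z.
Proof. by move=> h0; exact: integral_ge0. Qed.

Lemma measurable_indicE A : measurable A -> measurable_fun setT (fun p : T => (\1_A p)%:E : \bar R).
Proof. by move=> mA; apply/measurable_EFinP. Qed.

Lemma measurable_sub_comp h z : measurable_fun setT h -> measurable_fun setT (fun p : T => h (z - p)%R).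
Proof.
by move=> mh; apply: (measurableT_comp mh); apply: measurable_fun_subT.
Qed.

Lemma measurable_convol_kernel A h : measurable A -> measurable_fun setT h ->
  measurable_fun setT (fun zp : T * T => (\1_A zp.2)%:E * h (zp.1 - zp.2)%R).
Proof.
move=> mA mh; apply: emeasurable_funM.
  exact: (measurableT_comp (measurable_indicE mA)).
apply: (measurableT_comp mh); exact: measurable_fun_subT.
Qed.

Lemma measurable_convol A h : measurable A -> measurable_fun setT h ->
  (forall z, 0 <= h z) -> measurable_fun setT (convol A h).
Proof.
move=> mA mh h0; under [convol A h]funext do rewrite /convol integral_indicM.
apply: (measurable_fun_fubini_tonelli_F (m2 := P) _ (measurable_convol_kernel mA mh)).
by move=> zp; rewrite mule_ge0.
Qed.

Lemma convol_translate c A h z : measurable A -> measurable_fun setT h ->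
  (forall z, 0 <= h z) ->
  convol [set p | A (p - c)%R] h z = convol A h (z - c)%R.
Proof.
move=> mA mh h0; rewrite /convol [LHS]integral_indicM [RHS]integral_indicM.
rewrite -(integral_translate c).
- apply: eq_integral => p _; congr (_ * h _); last by rewrite opprD addrA addrAC.
  by congr (_%:E); rewrite !indicE; congr (_%:R); congr nat_of_bool;
    apply/idP/idP; rewrite !inE /= addrK.
- apply: emeasurable_funM; last exact: measurable_sub_comp.
  by apply: measurable_indicE; exact: measurable_translate.
- by move=> p; rewrite mule_ge0.
Qed.

Definition subgroup H := H 0%R /\ forall p q, H p -> H q -> H (p - q)%R.

Lemma subgroupN H p : subgroup H -> H p -> H (- p)%R.
Proof. by move=> [H0 HB] Hp; rewrite -sub0r; exact: HB. Qed.

Lemma subgroupD H p q : subgroup H -> H p -> H q -> H (p + q)%R.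
Proof.
by move=> gH Hp Hq; rewrite -[q]opprK; apply: gH.2 => //; exact: subgroupN.
Qed.

(** The substitution p -> p + q maps the subgroup H to itself, so the mean is
constant on the cosets of H. *)
Lemma convol_subgroup H h q z : subgroup H -> measurable H ->
  measurable_fun setT h -> (forall z, 0 <= h z) -> H q ->
  convol H h (z - q)%R = convol H h z.
Proof.
move=> gH mH mh h0 Hq; rewrite -convol_translate//; congr (convol _ _ _).
apply/seteqP; split => p /= Hp; last exact: gH.2.
by rewrite -(subrK q p); exact: subgroupD.
Qed.

(** By Fubini's theorem the left side is the integral over p in H of the integral
of h (z - p) over F; since F + p = F, the inner integral does not depend on p. *)
Lemma integral_convol_invariant H F h : measurable H -> measurable F ->
  measurable_fun setT h -> (forall z, 0 <= h z) ->
  (forall z q, H q -> F z -> F (z + q)%R) ->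
  (forall z q, H q -> F (z + q)%R -> F z) ->
  \int[P]_(z in F) convol H h z = P H * \int[P]_(z in F) h z.
Proof.
move=> mH mF mh h0 FD FB; rewrite integral_indicM.
under eq_integral => z _.
  rewrite /convol integral_indicM -ge0_integralZl//; last 2 first.
  - apply: emeasurable_funM; first exact: measurable_indicE.
    exact: measurable_sub_comp.
  - by move=> p _; rewrite mule_ge0.
  over.
rewrite (@fubini_tonelli _ _ T T R P P (fun zp : T * T =>
  (\1_F zp.1)%:E * ((\1_H zp.2)%:E * h (zp.1 - zp.2)%R))); first last.
- by move=> zp; rewrite !mule_ge0.
- apply: emeasurable_funM; last exact: measurable_convol_kernel.
  exact: (measurableT_comp (measurable_indicE mF)).
rewrite (integral_indicM F).
transitivity (\int[P]_p ((\1_H p)%:E * \int[P]_z ((\1_F z)%:E * h z))).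
  apply: eq_integral => p _ /=.
  rewrite [in RHS]indicE; case: (boolP (p \in H)) => [|pH]; last first.
    by rewrite mul0e integral0_eq// => z _; rewrite [\1_H p]indicE (negbTE pH) mul0e mule0.
  rewrite inE => Hp; rewrite mul1e.
  rewrite -[RHS](integral_translate (- p)%R).
  - apply: eq_integral => z _.
    rewrite [\1_H p]indicE mem_set// mul1e; congr (_%:E * _).
    rewrite !indicE; congr (_%:R); congr nat_of_bool.
    apply/idP/idP; rewrite !inE; last by move/FD => /(_ p Hp); rewrite subrK.
    by rewrite -{1}(subrK p z); exact: FB.
  - by apply: emeasurable_funM => //; exact: measurable_indicE.
  - by move=> z; rewrite mule_ge0.
rewrite ge0_integralZr//; last 2 first.
- exact: measurable_indicE.
- by apply: integral_ge0 => z _; rewrite mule_ge0.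
by rewrite integral_indic// setIT.
Qed.

End convolution.

(** * A weak type inequality for shifted means *)

Section weak_type.
Variables (R : realType) (m : nat -> nat).
Local Notation G := (vilenkin m).
Local Notation T := (G * G)%type.
Variable P : probability T R.
Hypothesis P_translate : forall (c : T) (A : set T),
  measurable A -> P [set z | A (z + c)] = P A.
Variable h : T -> \bar R.
Hypotheses (mh : measurable_fun setT h) (h0 : forall z, (0 <= h z)%E).
Local Open Scope ereal_scope.

Definition large_convol (A : set T) (w a : R) : set T :=
  [set z : T | a%:E < w%:E * convol P A h z].

Lemma measurable_large_convol A w a : measurable A -> measurable (large_convol A w a).
Proof.
move=> mA; rewrite -[X in measurable X]setTI.
apply: emeasurable_fun_o_infty => //.
by apply: measurable_funeM; exact: measurable_convol.
Qed.

(** Markov's inequality on a union F of cosets of H: integrating the lower bound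
over F turns the means of h back into h. *)
Lemma measure_large_convol_part H F (w a : R) :
  subgroup H -> measurable H -> measurable F ->
  (0 <= w)%R -> w%:E * P H <= 1 -> (0 <= a)%R ->
  F `<=` large_convol H w a ->
  (forall z q, H q -> F z -> F (z + q)%R) ->
  (forall z q, H q -> F (z + q)%R -> F z) ->
  a%:E * P F <= \int[P]_(z in F) h z.
Proof.
move=> gH mH mF w0 wH a0 FH FD FB.
have mc : measurable_fun F (convol P H h).
  by apply: measurable_funTS; exact: measurable_convol.
apply: (@le_trans _ _ (\int[P]_(z in F) (w%:E * convol P H h z))).
  rewrite -integral_cst//; apply: ge0_le_integral => //.
  - by apply: measurable_funeM.
  - by move=> z /FH /ltW.
rewrite ge0_integralZl//; last by move=> z _; exact: convol_ge0.
rewrite integral_convol_invariant// muleA.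
by rewrite -[leRHS]mul1e lee_wpmul2r// integral_ge0.
Qed.

(** Weak type (1,1) of a maximal function along decreasing subgroups, with means
centred away from z by tau.  Decompose the union of the level sets L i of the
unshifted means by the first index i at which a point enters (the sets F i).
The set to be measured consists of the L i + tau i, and F k + tau i = F k for
k < i because tau i lies in H (i - 1), hence in H k.  So only the F i + tau i are
new, and the total measure is at most twice that of the disjoint sets F i. *)
Lemma weak_type_nested (H : nat -> set T) (tau : nat -> T) (w : nat -> R) (a : R) :
  (forall i, subgroup (H i)) -> (forall i, measurable (H i)) ->
  (forall i, H i.+1 `<=` H i) -> (forall i, H i (tau i.+1)) ->
  (forall i, (0 <= w i)%R) -> (forall i, (w i)%:E * P (H i) <= 1) -> (0 <= a)%R ->
  a%:E * P (\bigcup_i large_convol [set p | H i (p - tau i)%R] (w i) a) <=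
    2%:E * \int[P]_z h z.
Proof.
move=> gH mH decH Htau w0 wH a0.
have Hle i j : (i <= j)%N -> H j `<=` H i.
  move=> /subnK <-; elim: (j - i)%N => [|k IH]//.
  exact: (subset_trans (decH _)).
pose L i := large_convol (H i) (w i) a.
have mL i : measurable (L i) by exact: measurable_large_convol.
have Linv i z q : H i q -> L i (z - q)%R = L i z.
  by move=> Hq; rewrite /L /large_convol /= convol_subgroup.
pose F := seqDU L.
have mF i : measurable (F i) by exact: seqDU_measurable.
have FE i z : F i z <-> L i z /\ forall j, (j < i)%N -> ~ L j z.
  rewrite /F /seqDU; split => [[Lz nLz]|[Lz nLz]]; split => //.
    by move=> j ji Ljz; apply: nLz; rewrite -bigcup_mkord; exists j.
  by rewrite -bigcup_mkord => -[j /= ji]; exact: nLz.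
have Finv i z q : H i q -> F i (z - q)%R <-> F i z.
  move=> Hq; split => /FE[Lz nLz]; apply/FE.
    rewrite -(Linv i z q)//; split => // j ji.
    by rewrite -(Linv j z q)//; [exact: nLz|exact: (Hle _ _ (ltnW ji))].
  rewrite (Linv i z q)//; split => // j ji.
  by rewrite (Linv j z q)//; [exact: nLz|exact: (Hle _ _ (ltnW ji))].
have FinvD i z q : H i q -> F i (z + q)%R <-> F i z.
  by move=> Hq; rewrite -[q]opprK; apply: Finv; exact: subgroupN.
pose F' i := [set z | F i (z - tau i)%R].
have mF' i : measurable (F' i) by exact: measurable_translate.
have sub : \bigcup_i large_convol [set p | H i (p - tau i)%R] (w i) a `<=`
    (\bigcup_i F i) `|` (\bigcup_i F' i).
  move=> z [i _ Lz].
  have {}Lz : L i (z - tau i)%R.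
    by move: Lz; rewrite /L /large_convol /= convol_translate.
  have : (\bigcup_(k < i.+1) L k) (z - tau i)%R by exists i => /=.
  rewrite bigcup_mkord (bigsetU_seqDU L) -bigcup_mkord => -[k /=].
  rewrite ltnS leq_eqVlt => /orP[/eqP ->|ki] Fz; first by right; exists i.
  have Hk : H k (tau i).
    by case: i ki {Lz Fz} => // i ki; exact: (Hle k i ki _ (Htau i)).
  by left; exists k => //; exact: (Finv k z (tau i) Hk).1.
have mU : measurable (\bigcup_i large_convol [set p | H i (p - tau i)%R] (w i) a).
  apply: bigcup_measurable => i _; apply: measurable_large_convol.
  exact: measurable_translate.
have aF i : a%:E * P (F i) <= \int[P]_(z in F i) h z.
  apply: (measure_large_convol_part (H := H i) (w := w i)) => //.
  - by move=> z /FE[].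
  - by move=> z q /FinvD -> .
  - by move=> z q /FinvD -> .
have PF : a%:E * (\sum_(i <oo) P (F i)) <= \int[P]_z h z.
  rewrite -nneseriesZl//; apply: (@le_trans _ _ (\sum_(i <oo) \int[P]_(z in F i) h z)).
    by apply: lee_nneseries => // i _; rewrite mule_ge0.
  rewrite -ge0_integral_bigcup//; first last.
  - exact: trivIset_seqDU.
  - exact: measurable_funTS.
  by apply: ge0_subset_integral => //; exact: bigcup_measurable.
apply: (@le_trans _ _ (a%:E * (\sum_(i <oo) P (F i) + \sum_(i <oo) P (F i)))).
  apply: lee_wpmul2l; first by rewrite lee_fin.
  apply: (@le_trans _ _ (P ((\bigcup_i F i) `|` (\bigcup_i F' i)))).
    by apply: le_measure => //; rewrite inE//; apply: measurableU;
      exact: bigcup_measurable.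
  apply: le_trans (measureU2 _ _ _) _; try exact: bigcup_measurable.
  apply: leeD; first by apply: measure_sigma_subadditive => //; exact: bigcup_measurable.
  apply: (@le_trans _ _ (\sum_(i <oo) P (F' i))).
    by apply: measure_sigma_subadditive => //; exact: bigcup_measurable.
  by apply: lee_nneseries => // i _; rewrite P_translate.
rewrite -mule2n -[X in _ * X]mule_natl muleCA lee_wpmul2l//.
Qed.

(** Subgroups squeezed between I j and I (j - n) need not decrease, but they do
along each of the n + 1 classes of j modulo n + 1, where the shifts also fall
into the preceding subgroup.  The price is a factor n + 1, which is negligible
against the factor 2 ^ - n that W attaches to a spread of n levels. *)
Lemma weak_type_spread (n : nat) (I : nat -> set T) (H : nat -> set T)
    (tau : nat -> T) (w : nat -> R) (a : R) :
  (forall j, subgroup (H j)) -> (forall j, measurable (H j)) ->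
  {homo I : i j / (i <= j)%N >-> j `<=` i} ->
  (forall j, I j `<=` H j) -> (forall j, H j `<=` I (j - n)%N) ->
  (forall j, I (j - n)%N (tau j)) ->
  (forall j, (0 <= w j)%R) -> (forall j, (w j)%:E * P (H j) <= 1) -> (0 <= a)%R ->
  a%:E * P (\bigcup_j large_convol [set p | H j (p - tau j)%R] (w j) a) <=
    (2 * n.+1)%:R%:E * \int[P]_z h z.
Proof.
move=> gH mH decI IH HI Itau w0 wH a0.
pose L j := large_convol [set p | H j (p - tau j)%R] (w j) a.
have mL j : measurable (L j).
  by apply: measurable_large_convol; exact: measurable_translate.
pose U r := \bigcup_i L (r + i * n.+1)%N.
have mU r : measurable (U r) by exact: bigcup_measurable.
have step r i : (r + i * n.+1 <= r + i.+1 * n.+1 - n)%N.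
  by rewrite mulSn addnCA addSnnS addKn leqnSn.
have aU r : a%:E * P (U r) <= 2%:E * \int[P]_z h z.
  apply: (weak_type_nested (H := fun i => H (r + i * n.+1)%N)
     (tau := fun i => tau (r + i * n.+1)%N) (w := fun i => w (r + i * n.+1)%N)) => //.
  - by move=> i; apply: subset_trans (IH _); apply: subset_trans (HI _) _; exact: decI.
  - by move=> i; apply: IH; apply: (decI _ _ (step r i)); exact: Itau.
have -> : \bigcup_j L j = \big[setU/set0]_(r < n.+1) U r.
  rewrite -bigcup_mkord; apply/seteqP; split => z.
    move=> [j _ Lz]; exists (j %% n.+1)%N; first by rewrite /= ltn_mod.
    by exists (j %/ n.+1)%N => //; rewrite addnC -divn_eq.
  by move=> [r _ [i _ Lz]]; exists (r + i * n.+1)%N.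
apply: (@le_trans _ _ (\sum_(r < n.+1) a%:E * P (U r))).
  rewrite -ge0_sume_distrr//; apply: lee_wpmul2l; first by rewrite lee_fin.
  suff: measurable (\big[setU/set0]_(r < n.+1) U r) /\
      P (\big[setU/set0]_(r < n.+1) U r) <= \sum_(r < n.+1) P (U r) by case.
  apply: (big_ind2 (fun A s => measurable A /\ P A <= s)) => //=.
  - by rewrite measure0.
  - move=> A1 x1 A2 x2 [m1 A1x1] [m2 A2x2]; split; first exact: measurableU.
    by apply: le_trans (measureU2 _ _ _) _ => //; exact: leeD.
apply: (@le_trans _ _ (\sum_(r < n.+1) 2%:E * \int[P]_z h z)).
  by apply: lee_sum => r _; exact: aU.
rewrite -ge0_sume_distrl; last by move=> r _; rewrite lee_fin.
by rewrite sumEFin sumr_const card_ord -[2%R]/(2%:R)%R -mulrnA.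
Qed.

End weak_type.

(** * The kernels of W as translates of subgroups *)

Section kernels.
Variables (R : realType) (m : nat -> nat).
Hypothesis m_ge2 : forall k, (2 <= m k)%N.
Local Notation G := (vilenkin m).
Local Notation T := (G * G)%type.
Variable mu : probability G R.
Hypothesis mu_haar : normalized_haar mu.
Local Notation P := (mu \x mu)%E.
Local Notation M n := ((radix m n)%:R : R).

Definition vball n : set G := cylinder n (0 : G).

Definition antidiag (k j : nat) : set T :=
  [set p | [/\ vball k p.1, vball k p.2 &
    forall l, (k < l < j)%N -> p.1 l + p.2 l = 0]].

(** Up to a translation, every domain of integration in W is one of these
subgroups.  The flag s selects the support of the product r_(k+1,j-1) against a
rectangle; the flag b tells that the translation moves the second coordinate,
as in the first and third sums of W. *)
Definition carrier (s b : bool) (k j : nat) : set T :=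
  if s then antidiag k j
  else if b then vball j `*` vball k else vball k `*` vball j.

(** Normalized so that each summand of W is at most M_q / M_j times weight times
an integral over a translate of the carrier, with weight times measure at most 1.
For s the factor M_j / M_(k+1) is the value of r_(k+1,j-1) on its support. *)
Definition weight (s : bool) (k j : nat) : R :=
  if s then M k ^+ 2 * M j / M k.+1 else M k * M j.

Definition offset (b : bool) (q a : nat) : T :=
  if b then (0, single m q a) else (single m q a, 0).

Definition square n : set T := vball n `*` vball n.

Lemma radix_gt0 n : (0 < radix m n)%N.
Proof. by apply: prodn_gt0 => k; exact: leq_trans (m_ge2 k). Qed.

Lemma radixS n : radix m n.+1 = (radix m n * m n)%N.
Proof. by rewrite /radix big_ord_recr. Qed.

Lemma vballB n x y : vball n x -> vball n y -> vball n (x - y).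
Proof.
move=> xn yn k kn; change (x k - y k = 0); rewrite xn// yn//; exact: subr0.
Qed.

Lemma vball_le i j : (i <= j)%N -> vball j `<=` vball i.
Proof. by move=> ij x xj k ki; apply: xj; exact: leq_trans ij. Qed.

Lemma subgroup_square n : subgroup (square n).
Proof.
by split=> [|p q [p1 p2] [q1 q2]]; split => //=; exact: vballB.
Qed.

Lemma subgroup_carrier s b k j : subgroup (carrier s b k j).
Proof.
rewrite /carrier; case: s; last first.
  by case: b; split=> [|p q [p1 p2] [q1 q2]]; split => //=; exact: vballB.
split=> [|p q [p1 p2 p12] [q1 q2 q12]]; split => //=.
- by move=> l _; exact: addr0.
- exact: vballB.
- exact: vballB.
- move=> l kl; change (p.1 l - q.1 l + (p.2 l - q.2 l) = 0).
  by rewrite addrACA -opprD p12// q12// subr0.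
Qed.

Lemma square_le i j : (i <= j)%N -> square j `<=` square i.
Proof. by move=> ij [x y] [xj yj]; split; exact: (vball_le ij). Qed.

Lemma square_carrier s b k j : (k <= j)%N -> square j `<=` carrier s b k j.
Proof.
move=> kj [x y] [/= xj yj]; rewrite /carrier; case: s; last first.
  by case: b; split => //=; exact: (vball_le kj).
split; [exact: (vball_le kj)|exact: (vball_le kj)|] => l /andP[_ lj] /=.
rewrite xj// yj//; exact: addr0.
Qed.

Lemma carrier_square s b k j : (k <= j)%N -> carrier s b k j `<=` square k.
Proof.
move=> kj [x y]; rewrite /carrier; case: s; first by case.
by case: b => -[/= xj yj]; split => //=; exact: (vball_le kj).
Qed.

Lemma offset_square b q a : square q (offset b q a).
Proof.
by rewrite /offset; case: b; split => //= k kq; rewrite /single (ltn_eqF kq).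
Qed.

Lemma measurable_cylinder n (x : G) : measurable (cylinder n x).
Proof.
rewrite (_ : cylinder n x = \bigcap_(k in `I_n) [set y : G | y k = x k]).
  by apply: fin_bigcap_measurable => // k _; exact: measurable_coord.
by apply/seteqP; split => y /= yx k kn; exact: yx.
Qed.

Lemma measurable_square n : measurable (square n).
Proof. by apply: measurableX; exact: measurable_cylinder. Qed.

Lemma measurable_carrier s b k j : measurable (carrier s b k j).
Proof.
have mb i : measurable (vball i) by exact: measurable_cylinder.
rewrite /carrier; case: s; last by case: b; exact: measurableX.
rewrite (_ : antidiag k j = square k `&`
    \bigcap_(l in [set l | (k < l < j)%N])
      ([set p | p.1 l + p.2 l = 0])); last first.
  apply/seteqP; split => p /=; first by case=> p1 p2 p12; split.
  by case=> -[p1 p2] p12; split.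
apply: measurableI; first exact: measurable_square.
apply: bigcap_measurableType => l _.
rewrite (_ : [set _ | _] = \bigcup_(a in [set: 'Z_(m l)])
    ([set x : G | x l = a] `*` [set x : G | x l = - a])).
  apply: fin_bigcup_measurable => // a _.
  by apply: measurableX; exact: measurable_coord.
apply/seteqP; split => [[x y] /= xy|[x y] [a _ /= [-> ->]]]; last exact: subrr.
by exists (x l) => //=; split => //; apply/eqP; rewrite -addr_eq0 addrC xy.
Qed.

Lemma card_Zm k : #|'Z_(m k)| = m k.
Proof. by rewrite card_ord Zp_cast// m_ge2. Qed.

Lemma haar_cylinder n (x : G) : mu (cylinder n x) = ((M n)^-1)%:E.
Proof.
have := mu_haar n (fun k => finset.set1 (x k)).
rewrite (_ : [set y | _] = cylinder n x); last first.
  by apply/seteqP; split => y /= yx k kn; have := yx k kn; rewrite finset.in_set1 => /eqP.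
move=> ->; congr (_%:E).
under eq_bigr do rewrite finset.cards1 mul1r.
by rewrite prodfV /radix natr_prod.
Qed.

(** By Fubini's theorem: once the first point is fixed in the ball of order k,
all coordinates of index less than j of the second one are prescribed, except
the k-th. *)
Lemma measure_antidiag k j : (k <= j)%N ->
  (P (antidiag k j) <= ((M k.+1) / (M k ^+ 2 * M j))%:E)%E.
Proof.
move=> kj; have Mn0 n : M n != 0 by rewrite pnatr_eq0 -lt0n radix_gt0.
have -> : (M k.+1) / (M k ^+ 2 * M j) = (m k)%:R / M j * (M k)^-1.
  by rewrite radixS natrM; field; rewrite !Mn0.
rewrite EFinM -(haar_cylinder k (0 : G)) -/(vball k).
have mb : measurable (vball k) by exact: measurable_cylinder.
have mA : measurable (antidiag k j) by exact: (measurable_carrier true true).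
rewrite -[X in (_ * mu X)%E]setIT -integral_indic// -ge0_integralZl//; last exact/measurable_EFinP.
rewrite /product_measure1; apply: ge0_le_integral => //.
- exact: measurable_fun_xsection.
- by apply: measurable_funeM; apply/measurable_EFinP.
move=> x _ /=; rewrite indicE.
have [|xk] := boolP (x \in vball k); last first.
  rewrite mule0 (_ : xsection _ _ = set0) ?measure0//.
  apply/seteqP; split => // y; rewrite /xsection /= inE => -[/= xb _ _].
  by move: xk; rewrite notin_setE.
rewrite inE mule1 => xk.
pose A l : {set 'Z_(m l)} := if (l < k)%N then finset.set1 0 else
  if l == k then [set: 'Z_(m l)]%SET else finset.set1 (- x l).
have -> : xsection (antidiag k j) x = [set y | forall l, (l < j)%N -> y l \in A l].
  apply/seteqP; split => y; rewrite /xsection /= inE /=.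
    move=> [/= _ yk xy] l lj; rewrite /A; case: ltngtP => [lk|kl|_].
    - by rewrite finset.in_set1 yk.
    - by rewrite finset.in_set1 -addr_eq0 addrC xy// kl.
    - by rewrite finset.in_setT.
  move=> yA; split => //= [l lk|l /andP[kl lj]].
    by have := yA l (leq_trans lk kj); rewrite /A lk finset.in_set1 => /eqP.
  have := yA l lj; rewrite /A ltnNge (ltnW kl) /= gtn_eqF// finset.in_set1.
  by rewrite -addr_eq0 addrC => /eqP.
rewrite mu_haar lee_fin prodf_div -!natr_prod -/(radix m j).
rewrite ler_wpM2r// ler_nat (eq_bigr (fun l : 'I_j => if l == k :> nat then m l else 1)).
  rewrite -big_mkcond big_ord1_eq; case: ifP => // _.
  exact: leq_trans (m_ge2 k).
move=> l _; rewrite /A; case: ltngtP => _; rewrite ?finset.cards1//.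
by rewrite finset.cardsT card_Zm.
Qed.

Lemma weight_ge0 s k j : 0 <= weight s k j.
Proof. by rewrite /weight; case: s; rewrite ?divr_ge0// mulr_ge0// ?exprn_ge0. Qed.

Lemma weight_carrier s b k j : (k <= j)%N ->
  ((weight s k j)%:E * P (carrier s b k j) <= 1)%E.
Proof.
have Mn0 n : M n != 0 by rewrite pnatr_eq0 -lt0n radix_gt0.
move=> kj; rewrite /carrier; case: s.
  apply: (le_trans (lee_wpmul2l _ (measure_antidiag kj))).
    by rewrite lee_fin weight_ge0.
  rewrite -EFinM lee_fin le_eqVlt; apply/orP; left; apply/eqP.
  by rewrite /weight; field; rewrite !Mn0.
have mb i : measurable (vball i) by exact: measurable_cylinder.
suff -> : P (if b then vball j `*` vball k else vball k `*` vball j) =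
    ((M k * M j)^-1)%:E.
  by rewrite -EFinM mulfV// mulf_neq0.
have hb i : mu (vball i) = ((M i)^-1)%:E := haar_cylinder i 0.
case: b; rewrite [LHS]product_measure1E// [X in (X * _)%E]hb [X in (_ * X)%E]hb;
  by rewrite -EFinM invfM// mulrC.
Qed.

(** The domain of integration with q = j - n and k = j - d.  Keeping n and d
instead of q and k groups the summands of all the W_j into families indexed by
j alone, one for each maximal function.  For j < n the truncated differences
still give subgroups and shifts to which the weak type inequality applies. *)
Definition shifted_carrier n d s b a j : set T :=
  [set p | carrier s b (j - d) j (p - offset b (j - n) a)].

Lemma measurable_shifted_carrier n d s b a j :
  measurable (shifted_carrier n d s b a j).
Proof. by apply: measurable_translate; exact: measurable_carrier. Qed.

Lemma shifted_carrier_square n d s b a j : (d <= n)%N ->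
  shifted_carrier n d s b a j `<=` square (j - n).
Proof.
move=> dn p /(carrier_square (leq_subr d j)) /(square_le (leq_sub2l j dn)) ps.
rewrite -(subrK (offset b (j - n) a) p).
by apply: subgroupD ps _; [exact: subgroup_square|exact: offset_square].
Qed.

Lemma weight_shifted_carrier n d s b a j :
  ((weight s (j - d) j)%:E * P (shifted_carrier n d s b a j) <= 1)%E.
Proof.
rewrite [X in (_ * X)%E](haar2_translate mu_haar)//; last exact: measurable_carrier.
by apply: weight_carrier; exact: leq_subr.
Qed.

(** Both the carrier and the shift lie between the levels j - n and j. *)
Lemma weak_type_kernel (h : T -> \bar R) n d s b a (lam : R) : (d <= n)%N ->
  measurable_fun setT h -> (forall z, 0 <= h z)%E -> 0 <= lam ->
  (lam%:E * P (\bigcup_j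
      large_convol P h (shifted_carrier n d s b a j) (weight s (j - d) j) lam) <=
    (2 * n.+1)%:R%:E * \int[P]_z h z)%E.
Proof.
move=> dn mh h0 lam0.
apply: (weak_type_spread (haar2_translate mu_haar) mh h0
  (I := square) (H := fun j => carrier s b (j - d) j)
  (tau := fun j => offset b (j - n) a)) => //.
- by move=> j; exact: subgroup_carrier.
- by move=> j; exact: measurable_carrier.
- by move=> i j; exact: square_le.
- by move=> j; apply: square_carrier; exact: leq_subr.
- move=> j; apply: subset_trans (carrier_square (leq_subr d j)) _.
  by apply: square_le; exact: leq_sub2l.
- by move=> j; exact: offset_square.
- by move=> j; exact: weight_ge0.
- by move=> j; apply: weight_carrier; exact: leq_subr.
Qed.

End kernels.

(** * Density of functions of finitely many coordinates *)

Section approximation_by_algebra.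
Context d (T : measurableType d) (R : realType) (P : probability T R).
Variable C : set (set T).
Hypotheses (CM : C `<=` measurable) (C0 : C set0).
Hypotheses (CC : forall B, C B -> C (~` B)).
Hypotheses (CU : forall A B, C A -> C B -> C (A `|` B)).

Definition symdiff (A B : set T) := (A `\` B) `|` (B `\` A).

Lemma measurable_symdiff A B :
  measurable A -> measurable B -> measurable (symdiff A B).
Proof. by move=> mA mB; apply: measurableU; exact: measurableD. Qed.

Definition approx_set A := measurable A /\
  forall e : R, 0 < e -> exists2 B, C B & (P (symdiff A B) <= e%:E)%E.

Let approx0 : approx_set set0.
Proof.
split => // e e0; exists set0 => //.
by rewrite /symdiff setDv setU0 measure0 lee_fin ltW.
Qed.

Let approxC A : approx_set A -> approx_set (~` A).
Proof.
move=> [mA aA]; split; first exact: measurableC.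
move=> e /aA[B CB PB]; exists (~` B); first exact: CC.
by rewrite /symdiff !setDE !setCK setUC [~` B `&` _]setIC [~` A `&` _]setIC -!setDE.
Qed.

Let approxU A A' : approx_set A -> approx_set A' -> approx_set (A `|` A').
Proof.
move=> [mA aA] [mA' aA']; split; first exact: measurableU.
move=> e e0; have e20 : 0 < e / 2 by rewrite divr_gt0.
have [B CB PB] := aA _ e20; have [B' CB' PB'] := aA' _ e20.
have [mB mB'] := (CM CB, CM CB').
exists (B `|` B'); first exact: CU.
apply: (@le_trans _ _ (P (symdiff A B `|` symdiff A' B'))).
  apply: le_measure; rewrite ?inE.
  - by apply: measurable_symdiff; exact: measurableU.
  - by apply: measurableU; exact: measurable_symdiff.
  by move=> x [[[Ax|Ax] /not_orP[nB nB']]|[[Bx|Bx] /not_orP[nA nA']]];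
    [left; left|right; left|left; right|right; right].
apply: le_trans (measureU2 _ _ _) _; try exact: measurable_symdiff.
by rewrite [e]splitr EFinD; exact: leeD.
Qed.

Let approx_bigcup (F : nat -> set T) :
  (forall n, approx_set (F n)) -> approx_set (\bigcup_n F n).
Proof.
move=> aF; have mF n : measurable (F n) by have [] := aF n.
have mUF : measurable (\bigcup_n F n) by exact: bigcup_measurable.
split => // e e0; have e20 : 0 < e / 2 by rewrite divr_gt0.
pose U n := \big[setU/set0]_(i < n) F i.
have aU n : approx_set (U n).
  by rewrite /U; elim/big_ind : _ => // i _; exact: aF.
have mU n : measurable (U n) by have [] := aU n.
pose D n := \bigcup_n F n `\` U n.
have mD n : measurable (D n) by exact: measurableD.
have [N PN] : exists N, (P (D N) <= (e / 2)%:E)%E.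
  have : (P \o D) n @[n --> \oo] --> P (\bigcap_n D n).
    apply: nonincreasing_cvg_mu => //.
    - by rewrite (le_lt_trans (probability_le1 _ _))// ltry.
    - exact: bigcapT_measurable.
    - move=> i j ij; apply/subsetPset; apply: setDS.
      by move=> x; rewrite /U -!bigcup_mkord => -[k /= ki Fx]; exists k => //=; exact: leq_trans ij.
  have -> : \bigcap_n D n = set0.
    apply/seteqP; split => // x Dx.
    have [[n _ Fx] _] := Dx 0%N I.
    have [_] := Dx n.+1 I; apply.
    by rewrite /U -bigcup_mkord; exists n => /=.
  rewrite measure0 => /(_ [set y | y < (e / 2)%:E]%E) [].
    by apply: open_nbhs_nbhs; split; [exact: open_ereal_lt_ereal|rewrite /= lte_fin].
  by move=> N _ /(_ N (leqnn N)) /ltW PN; exists N.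
have [B CB PB] := (aU N).2 _ e20; have mB := CM CB; exists B => //.
apply: (@le_trans _ _ (P (D N `|` symdiff (U N) B))).
  apply: le_measure; rewrite ?inE.
  - exact: measurable_symdiff.
  - by apply: measurableU => //; exact: measurable_symdiff.
  move=> x [[Ux nB]|[Bx nU]]; last first.
    right; right; split => // UNx; apply: nU.
    by move: UNx; rewrite /U -bigcup_mkord => -[i _ Fx]; exists i.
  by have [UNx|UNx] := pselect (U N x); [right; left|left].
apply: le_trans (measureU2 _ _ _) _ => //; first exact: measurable_symdiff.
by rewrite [e]splitr EFinD; exact: leeD.
Qed.

(** Approximability passes to complements and to finite unions, hence to
countable ones because a finite measure is continuous along the remainders. *)
Lemma approx_algebra A : <<s C >> A -> approx_set A.
Proof.
apply: smallest_sub; first split => //.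
- by move=> B aB; rewrite setTD; exact: approxC.
- by move=> B CB; split; [exact: CM|]; move=> e e0; exists B => //;
    rewrite /symdiff setDv setU0 measure0 lee_fin ltW.
Qed.

End approximation_by_algebra.

Import HBSimple.

Section density.
Variables (R : realType) (m : nat -> nat).
Local Notation G := (vilenkin m).
Local Notation T := (G * G)%type.
Variable P : probability T R.

Definition cylindrical n (U : Type) (g : T -> U) :=
  forall z p, square n p -> g (z - p) = g z.

Lemma cylindrical_le n n' (U : Type) (g : T -> U) : (n <= n')%N ->
  cylindrical n g -> cylindrical n' g.
Proof. by move=> nn' cg z p /(square_le nn'); exact: cg. Qed.

Let C : set (set T) := [set B | measurable B /\ exists n, cylindrical n B].

(* A set fixing one coordinate of one component is already cylindrical. *)
Let measurable_prod_sub : measurable `<=` <<s C >>.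
Proof.
have sC : sigma_algebra setT <<s C >> by exact: smallest_sigma_algebra.
have side (pr : T -> G) :
    (forall k (a : 'Z_(m k)), C [set z | pr z k = a]) ->
    preimage_set_system setT pr measurable `<=` <<s C >>.
  move=> Cpr _ [A mA <-].
  move: A mA; apply: smallest_sub; first split.
  - by rewrite preimage_set0 setI0; exact: sigma_algebra0.
  - move=> A; rewrite !setTI setTD preimage_setC -setTD; exact: sigma_algebraCD.
  - by move=> F sF; rewrite preimage_bigcup setTI; apply: sigma_algebra_bigcup => i;
      have := sF i; rewrite setTI.
  by move=> _ [k [a ->]]; rewrite setTI; apply: sub_sigma_algebra; exact: Cpr.
have fixed k (x y : G) : vball k.+1 y -> x k - y k = x k.
  by move=> yk; rewrite yk//; exact: subr0.
apply: smallest_sub => //; rewrite subUset; split; apply: side => k a; split.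
- rewrite (_ : [set z | _] = [set x : G | x k = a] `*` setT).
    by apply: measurableX => //; exact: measurable_coord.
  by apply/seteqP; split => [[x y]|[x y] []].
- exists k.+1 => z p [p1 _].
  by change ((z.1 k - p.1 k = a) = (z.1 k = a)); rewrite fixed.
- rewrite (_ : [set z | _] = setT `*` [set x : G | x k = a]).
    by apply: measurableX => //; exact: measurable_coord.
  by apply/seteqP; split => [[x y]|[x y] []].
- exists k.+1 => z p [_ p2].
  by change ((z.2 k - p.2 k = a) = (z.2 k = a)); rewrite fixed.
Qed.

Definition cylinder_approx (u : T -> R) := forall e : R, 0 < e ->
  exists N (g : T -> R) (S : R),
  [/\ measurable_fun setT g, cylindrical N g, forall z, `|g z| <= S &
    (\int[P]_z (`|u z - g z|%:E) <= e%:E)%E].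

Let approx_indic (A : set T) : measurable A -> cylinder_approx (\1_A : T -> R).
Proof.
move=> mA e e0.
have [|||||_ /(_ e e0)[B [mB [n cB]] PB]] := @approx_algebra _ T R P C _ _ _ _ A.
- by move=> B [].
- by split => //; exists 0%N.
- move=> B [mB [n cB]]; split; first exact: measurableC.
  by exists n => z p /cB zp; rewrite /setC /= zp.
- move=> B B' [mB [n cB]] [mB' [n' cB']]; split; first exact: measurableU.
  exists (maxn n n') => z p pn; rewrite /setU /=.
  rewrite (cylindrical_le (leq_maxl n n') cB _ pn).
  by rewrite (cylindrical_le (leq_maxr n n') cB' _ pn).
- exact: measurable_prod_sub.
exists n, (\1_B : T -> R), 1; split => //.
- by move=> z p /cB zp; rewrite !indicE; congr (_%:R); congr nat_of_bool;
    apply/idP/idP; rewrite !inE zp.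
- by move=> z; rewrite indicE; case: (_ \in _); rewrite ?normr1// normr0.
apply: le_trans PB; rewrite -[X in (_ <= P X)%E]setIT -integral_indic //; last first.
  exact: measurable_symdiff.
rewrite le_eqVlt; apply/orP; left; apply/eqP; apply: eq_integral => z _.
congr (_%:E); rewrite !indicE.
have -> : (z \in symdiff A B) = (z \in A) (+) (z \in B).
  rewrite /symdiff in_setU !in_setD.
  by case: (z \in A); case: (z \in B).
by case: (z \in A); case: (z \in B);
  rewrite ?subrr ?normr0 ?subr0 ?sub0r ?normrN ?normr1.
Qed.

Let approxD u v : measurable_fun setT u -> measurable_fun setT v ->
  cylinder_approx u -> cylinder_approx v -> cylinder_approx (fun z => u z + v z).
Proof.
move=> mu mv au av e e0; have e20 : 0 < e / 2 by rewrite divr_gt0.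
have [n [g [S [mg cg gS ug]]]] := au _ e20.
have [n' [g' [S' [mg' cg' gS' vg']]]] := av _ e20.
exists (maxn n n'), (fun z => g z + g' z), (S + S'); split.
- exact: measurable_funD.
- move=> z p pn; rewrite (cylindrical_le (leq_maxl n n') cg _ pn).
  by rewrite (cylindrical_le (leq_maxr n n') cg' _ pn).
- by move=> z; apply: le_trans (ler_normD _ _) _; exact: lerD.
apply: (@le_trans _ _ (\int[P]_z (`|u z - g z|%:E + `|v z - g' z|%:E))%E).
  apply: ge0_le_integral => //.
  - by apply/measurable_EFinP; apply: measurableT_comp => //;
      apply: measurable_funB; exact: measurable_funD.
  - by apply: emeasurable_funD; apply/measurable_EFinP; apply: measurableT_comp => //;
      exact: measurable_funB.
  - move=> z _; rewrite -EFinD lee_fin; apply: le_trans (ler_normD _ _).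
    by rewrite opprD addrACA.
rewrite ge0_integralD//.
- by rewrite [e]splitr EFinD; exact: leeD.
- by apply/measurable_EFinP; apply: measurableT_comp => //; exact: measurable_funB.
- by apply/measurable_EFinP; apply: measurableT_comp => //; exact: measurable_funB.
Qed.

Let approxZ k u : measurable_fun setT u ->
  cylinder_approx u -> cylinder_approx (fun z => k * u z).
Proof.
move=> mu au e e0; have k0 : 0 < `|k| + 1 by rewrite ltr_wpDl.
have [n [g [S [mg cg gS ug]]]] := au _ (divr_gt0 e0 k0).
exists n, (fun z => k * g z), (`|k| * S); split.
- exact: measurable_funM.
- by move=> z p pn; rewrite cg.
- by move=> z; rewrite normrM ler_wpM2l.
under eq_integral do rewrite -mulrBr normrM EFinM.
rewrite ge0_integralZl//; last first.
  by apply/measurable_EFinP; apply: measurableT_comp => //; exact: measurable_funB.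
apply: le_trans (lee_wpmul2l _ ug) _; first by rewrite lee_fin.
by rewrite -EFinM lee_fin mulrCA ger_pMr// ler_pdivrMr// mul1r lerDl.
Qed.

Let approx_sum (I : Type) (s : seq I) (u : I -> T -> R) :
  (forall i, measurable_fun setT (u i)) -> (forall i, cylinder_approx (u i)) ->
  cylinder_approx (fun z => \sum_(i <- s) u i z).
Proof.
move=> mu au; elim: s => [|i s IH].
  move=> e e0; exists 0%N, (fun=> 0), 0; split => //.
  - by move=> z; rewrite normr0.
  under eq_integral do rewrite big_nil subrr normr0.
  by rewrite integral0 lee_fin ltW.
under [X in cylinder_approx X]funext do rewrite big_cons.
by apply: approxD => //; exact: measurable_sum.
Qed.

(** An integrable function is an L1 limit of simple ones, and the indicator of a
measurable set is an L1 limit of indicators of cylindrical sets. *)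
Lemma integrable_cylinder_approx (u : T -> R) :
  P.-integrable setT (EFin \o u) -> cylinder_approx u.
Proof.
move=> iu e e0; have e20 : 0 < e / 2 by rewrite divr_gt0.
have [g [ig _ ug]] := approximation_sfun_integrable measurableT iu.
have [k uk] : exists k, (\int[P]_z `|(EFin \o u) z - (g k z)%:E| <= (e / 2)%:E)%E.
  move: ug => /(_ [set y | y < (e / 2)%:E]%E) [].
    by apply: open_nbhs_nbhs; split; [exact: open_ereal_lt_ereal|rewrite /= lte_fin].
  by move=> N _ /(_ N (leqnn N)) /ltW PN; exists N.
have mu : measurable_fun setT u by apply/measurable_EFinP; exact: measurable_int iu.
have : cylinder_approx (g k).
  have -> : (g k : T -> R) = fun z => \sum_(y <- finmap.enum_fset (fset_set (range (g k))))
      y * \1_(g k @^-1` [set y]) z.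
    by apply/funext => z; rewrite {1}fimfunE fsbig_finite.
  apply: approx_sum => y.
    by apply: measurable_funM => //.
  by apply: approxZ => //; exact: approx_indic.
move=> /(_ _ e20)[n [g' [S [mg' cg' gS' ug']]]].
exists n, g', S; split => //.
apply: (@le_trans _ _ (\int[P]_z (`|u z - g k z|%:E + `|g k z - g' z|%:E))%E).
  apply: ge0_le_integral => //.
  - by apply/measurable_EFinP; apply: measurableT_comp => //; exact: measurable_funB.
  - by apply: emeasurable_funD; apply/measurable_EFinP; apply: measurableT_comp => //;
      exact: measurable_funB.
  - by move=> z _; rewrite -EFinD lee_fin -[X in `|X|](subrKA (g k z)) ler_normD.
rewrite ge0_integralD//.
- by rewrite [e]splitr EFinD; exact: leeD.
- by apply/measurable_EFinP; apply: measurableT_comp => //; exact: measurable_funB.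
- by apply/measurable_EFinP; apply: measurableT_comp => //; exact: measurable_funB.
Qed.

End density.

(** * Products of Vilenkin functions *)

Section vilenkin_characters.
Variables (R : realType) (m : nat -> nat).
Hypothesis m_ge2 : forall k, (2 <= m k)%N.
Local Notation G := (vilenkin m).
Local Notation T := (G * G)%type.
Local Open Scope complex_scope.

Lemma moivre (t : R) n : (cos t +i* sin t) ^+ n = cos (t *+ n) +i* sin (t *+ n).
Proof.
elim: n => [|n IH]; first by rewrite expr0 mulr0n cos0 sin0.
rewrite exprS IH mulrS cosD sinD; apply/eqP; rewrite eq_complex /=.
by rewrite eqxx addrC eqxx.
Qed.

Lemma cis_2pi n : cos (pi *+ 2 *+ n) +i* sin (pi *+ 2 *+ n) = 1 :> R[i].
Proof. by rewrite -moivre cos2pi sin2pi expr1n. Qed.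

Lemma rademacher_root l (x : G) : rademacher R l x ^+ m l = 1.
Proof.
have m0 : (m l)%:R != 0 :> R by rewrite pnatr_eq0 -lt0n (leq_trans _ (m_ge2 l)).
rewrite /rademacher moivre -[RHS](cis_2pi (x l : nat)).
have -> // : 2 * pi * (x l : nat)%:R / (m l)%:R *+ m l = pi *+ 2 *+ (x l : nat) :> R.
by rewrite -mulr_natr divfK// mulr_natr [2 * _]mulr_natl.
Qed.

(** The argument theta lies strictly between 0 and 2 pi, and
cos theta = 1 - 2 sin^2 (theta / 2) with theta / 2 strictly between 0 and pi. *)
Lemma rademacher_neq1 l (x : G) : x l != 0 -> rademacher R l x != 1.
Proof.
move=> xl; have m0 : 0 < (m l)%:R :> R by rewrite ltr0n (leq_trans _ (m_ge2 l)).
rewrite /rademacher; set theta := _ / _.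
have xm : (x l < m l)%N by rewrite -[X in (_ < X)%N](Zp_cast (m_ge2 l)).
have x0 : (0 < x l)%N by rewrite lt0n; apply: contra_neq xl => x0; exact: val_inj.
have t0 : 0 < sin (theta / 2).
  have -> : theta / 2 = pi * ((x l : nat)%:R / (m l)%:R).
    by rewrite /theta; field; rewrite gt_eqF.
  apply: sin_gt0_pi; rewrite mulr_gt0 ?pi_gt0 ?divr_gt0 ?ltr0n ?x0 ?(ltnW (m_ge2 l))//=.
  by rewrite gtr_pMr ?pi_gt0// ltr_pdivrMr// mul1r ltr_nat xm.
apply/eqP => /(congr1 (@complex.Re R)) /=.
rewrite [theta](_ : _ = (theta / 2) *+ 2); last by rewrite -mulr_natr divfK.
rewrite cos_mulr2n cos2sin2 => E.
suff : sin (theta / 2) ^+ 2 = 0 by move/eqP; rewrite sqrf_eq0 gt_eqF.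
by move: E; rewrite mulrnBl; lra.
Qed.

(** For x l nonzero this is a geometric sum whose ratio is an m_l-th root of
unity different from 1. *)
Lemma sum_rademacher l (x : G) :
  \sum_(s < m l) rademacher R l x ^+ s = if x l == 0 then (m l)%:R else 0.
Proof.
case: eqP => [x0|/eqP x0].
  rewrite [rademacher _ _ _](_ : _ = 1); last first.
    by rewrite /rademacher x0 /= mulr0 mul0r cos0 sin0.
  by under eq_bigr do rewrite expr1n; rewrite sumr_const card_ord.
have := subrX1 (rademacher R l x) (m l); rewrite rademacher_root subrr.
move/esym/eqP; rewrite mulf_eq0 subr_eq0 (negbTE (rademacher_neq1 x0)) /=.
by move/eqP.
Qed.

Lemma radix_ltn l : (l < radix m l)%N.
Proof.
elim: l => [|l IH]; first by rewrite /radix big_ord0.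
rewrite radixS; apply: (@leq_trans (radix m l * 2)).
  by rewrite muln2 -addnn -addn1 leq_add// (leq_trans _ IH).
by rewrite leq_mul2l m_ge2 orbT.
Qed.

Lemma radix_dvd k l : (k <= l)%N -> (radix m k %| radix m l)%N.
Proof.
move=> /subnK <-; elim: (l - k)%N => [|n IH]; first exact: dvdnn.
by rewrite addSn radixS dvdn_mulr.
Qed.

Lemma radix_lt k l : (k < l)%N -> (radix m k < radix m l)%N.
Proof.
move=> kl; apply: leq_trans (dvdn_leq (radix_gt0 m_ge2 _) (radix_dvd kl)).
by rewrite radixS ltn_Pmulr// radix_gt0.
Qed.

Lemma digit_radix l k : digit m (radix m l) k = (k == l).
Proof.
rewrite /digit; case: ltngtP => [kl|kl|->]; last first.
- by rewrite divnn radix_gt0// modn_small.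
- by rewrite divn_small ?mod0n// radix_lt.
- have /dvdnP[c ->] := radix_dvd kl.
  by rewrite radixS mulnCA mulKn ?radix_gt0// modnMl.
Qed.

Lemma psi_radix l (x : G) : psi R (radix m l) x = rademacher R l x.
Proof.
rewrite /psi (bigD1 (Ordinal (radix_ltn l))) //= digit_radix eqxx expr1.
rewrite big1 ?mulr1// => k kl; rewrite digit_radix.
suff /negbTE -> : (k != l :> nat) by rewrite expr0.
by apply: contra_neq kl => kl; exact: val_inj.
Qed.

(** The product is nonzero only where all its factors are, and the factor of index
l is then m_l. *)
Lemma rprodE k j (p : T) : (k < j)%N ->
  rprod R k.+1 j.-1 p =
  ((radix m j)%:R / (radix m k.+1)%:R *
     (`[< forall l, (k < l < j)%N -> p.1 l + p.2 l = 0 >])%:R)%:C.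
Proof.
move=> kj; have j0 : (0 < j)%N by exact: leq_ltn_trans kj.
rewrite /rprod prednK//.
under eq_bigr do (under eq_bigr do rewrite psi_radix; rewrite sum_rademacher).
have [h|h] := asboolP; last first.
  rewrite mulr0.
  have {h}[l [kl lj hl]] : exists l, [/\ (k < l)%N, (l < j)%N & p.1 l + p.2 l != 0].
    apply: contrapT => nl; apply: h => l /andP[kl lj].
    by apply/eqP/negPn/negP => hl; apply: nl; exists l.
  rewrite (big_rem l) ?mem_index_iota ?kl//=.
  rewrite -[(p.1 + p.2) l]/(p.1 l + p.2 l) (negbTE hl) mul0r//.
rewrite mulr1 [RHS](_ : _ = (\prod_(k.+1 <= l < j) (m l))%:R).
  rewrite natr_prod; apply: eq_big_nat => l kl.
  by rewrite -[(p.1 + p.2) l]/(p.1 l + p.2 l) h// eqxx.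
rewrite -(rmorph_nat (real_complex R)); congr (_%:C).
have r0 : (radix m k.+1)%:R != 0 :> R by rewrite pnatr_eq0 -lt0n radix_gt0.
apply: (mulIf r0); rewrite divfK// -natrM; congr (_%:R).
rewrite /radix -!(big_mkord xpredT) mulnC.
by rewrite -big_cat_nat.
Qed.

End vilenkin_characters.

(** * Domination of W by weighted means *)

Section bound_of_W.
Variables (R : realType) (m : nat -> nat).
Hypothesis m_ge2 : forall k, (2 <= m k)%N.
Local Notation G := (vilenkin m).
Local Notation T := (G * G)%type.
Variable mu : probability G R.
Hypothesis mu_haar : normalized_haar mu.
Local Notation P := (mu \x mu)%E.
Local Notation M n := ((radix m n)%:R : R).
Local Open Scope complex_scope.

Lemma cintegral_real (D : set T) (g : T -> R[i]) (r : T -> R) (B : R) :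
  (forall p, g p = (r p)%:C) -> (forall p, 0 <= r p) ->
  (\int[P]_(p in D) (r p)%:E <= B%:E)%E -> 0 <= cintegral P D g <= B%:C.
Proof.
move=> gr r0 rB; rewrite /cintegral.
have -> : (\int[P]_(p in D) complex.Im (g p))%R = 0.
  by under eq_Rintegral do rewrite gr; rewrite /Rintegral integral0.
under eq_Rintegral do rewrite gr /=.
rewrite -/((_ : R)%:C) -[0]/(0%:C) !lecR; apply/andP; split.
  by apply: Rintegral_ge0.
have I0 : (0 <= \int[P]_(p in D) (r p)%:E)%E by apply: integral_ge0 => p _; rewrite lee_fin.
by rewrite -lee_fin (le_trans _ rB)// /Rintegral fineK// ge0_fin_numE// (le_lt_trans rB)// ltry.
Qed.

Variable f : T -> R[i].

Definition oscillation (z p : T) : R := complex.Re (increment f z p).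

Lemma incrementE z p : increment f z p = (oscillation z p)%:C.
Proof. by rewrite /oscillation /increment normc_def. Qed.

Lemma oscillation_ge0 z p : 0 <= oscillation z p.
Proof. by rewrite -ler0c -incrementE normr_ge0. Qed.

Lemma cylinder_single n q a (x : G) :
  cylinder n (single m q a) x <-> vball n (x - single m q a).
Proof.
split=> xn k kn; first by change (x k - single m q a k = 0); rewrite xn// subrr.
by apply/eqP; rewrite -subr_eq0; apply/eqP; exact: xn.
Qed.

Lemma shifted_rectangle b q k j a : (q <= k <= j)%N ->
  shifted_carrier (j - q) (j - k) false b a j =
  if b then vball j `*` cylinder k (single m q a)
  else cylinder k (single m q a) `*` vball j.
Proof.
move=> /andP[qk kj]; have qj := leq_trans qk kj.
rewrite /shifted_carrier /carrier /offset !subKn//.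
by case: b; apply/seteqP; split => -[x y] /= [] h1 h2; split => //=;
  move: h1 h2; rewrite /= ?subr0 => h1 h2 //; apply/cylinder_single.
Qed.

Lemma shifted_antidiag b q k j a p : (q <= k <= j)%N ->
  shifted_carrier (j - q) (j - k) true b a j p <->
  (if b then vball k `*` cylinder k (single m q a)
   else cylinder k (single m q a) `*` vball k) p /\
  (forall l, (k < l < j)%N -> p.1 l + p.2 l = 0).
Proof.
move=> /andP[qk kj]; have qj := leq_trans qk kj.
have s0 l : (k < l)%N -> single m q a l = 0.
  by move=> kl; rewrite /single gtn_eqF// (leq_ltn_trans qk).
have sub0 (x : G) l : (k < l)%N -> (x - single m q a) l = x l.
  by move=> kl; change (x l - single m q a l = x l); rewrite s0// subr0.
rewrite /shifted_carrier /carrier /offset !subKn//; case: b; case: p => x y /=.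
  split => [[/= x0 y0 xy]|[[/= x0 y0] xy]]; split => //=.
  - by split => //=; [move: x0; rewrite /= subr0|apply/cylinder_single].
  - by move=> l /[dup] /andP[kl _] /xy; rewrite /= subr0 sub0.
  - by rewrite subr0.
  - exact/cylinder_single.
  - by move=> l /[dup] /andP[kl _] /xy; rewrite /= subr0 sub0.
split => [[/= x0 y0 xy]|[[/= x0 y0] xy]]; split => //=.
- by split => //=; [apply/cylinder_single|move: y0; rewrite /= subr0].
- by move=> l /[dup] /andP[kl _] /xy; rewrite /= subr0 sub0.
- exact/cylinder_single.
- by rewrite subr0.
- by move=> l /[dup] /andP[kl _] /xy; rewrite /= subr0 sub0.
Qed.

Hypothesis mosc : forall z, measurable_fun setT (oscillation z).

Definition osc_mean (s b : bool) (q k a j : nat) (z : T) : \bar R :=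
  ((weight R m s k j)%:E *
   \int[P]_(p in shifted_carrier (j - q) (j - k) s b a j) (oscillation z p)%:E)%E.

(** Here M_q M_k = (M_q / M_j) (M_k M_j), and the second factor is the weight. *)
Lemma rectangle_term b q k a j z (B : R) : (q <= k <= j)%N ->
  (osc_mean false b q k a j z <= B%:E)%E ->
  0 <= (radix m q)%:R * (radix m k)%:R *
    cintegral P (if b then cylinder j (0 : G) `*` cylinder k (single m q a)
                 else cylinder k (single m q a) `*` cylinder j (0 : G))
     (increment f z) <= (M q / M j * B)%:C.
Proof.
move=> qkj; rewrite /osc_mean shifted_rectangle// /weight => wB.
have Mj0 n : 0 < M n by rewrite ltr0n radix_gt0.
set D := if b then _ else _.
have : (\int[P]_(p in D) (oscillation z p)%:E <= (B / (M k * M j))%:E)%E.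
  by rewrite EFinM muleC lee_pdivlMl ?mulr_gt0//; move: wB; rewrite /D; case: b.
move=> /(cintegral_real (incrementE z) (oscillation_ge0 z))/andP[I0 IB].
rewrite !mulr_ge0//=.
apply: le_trans (ler_wpM2l _ IB) _; first by rewrite mulr_ge0.
rewrite -!(rmorph_nat (real_complex R)) -!rmorphM lecR le_eqVlt; apply/orP; left.
by apply/eqP; field; rewrite !gt_eqF.
Qed.

(** Restricting to the support of the product r_(k+1,j-1) turns the domain of
integration into a translate of the antidiagonal subgroup.  The factor 1 / M_j
stays outside, as in W. *)
Lemma antidiag_term b q k a j z (B : R) : (q <= k < j)%N ->
  (osc_mean true b q k a j z <= B%:E)%E ->
  0 <= (radix m q)%:R * (radix m k)%:R ^+ 2 *
    cintegral P (if b then cylinder k (0 : G) `*` cylinder k (single m q a)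
                 else cylinder k (single m q a) `*` cylinder k (0 : G))
     (fun p => increment f z p * rprod R k.+1 j.-1 p) <= (M q * B)%:C.
Proof.
move=> /andP[qk kj]; rewrite /osc_mean /weight => wB.
have qkj : (q <= k <= j)%N by rewrite qk ltnW.
have Mj0 n : 0 < M n by rewrite ltr0n radix_gt0.
set D := if b then _ else _.
pose r p := oscillation z p * (M j / M k.+1 *
  (`[< forall l, (k < l < j)%N -> p.1 l + p.2 l = 0 >])%:R).
have gr p : increment f z p * rprod R k.+1 j.-1 p = (r p)%:C.
  by rewrite incrementE rprodE// -rmorphM.
have r0 p : 0 <= r p.
  by rewrite mulr_ge0 ?oscillation_ge0// mulr_ge0// divr_ge0.
have : (\int[P]_(p in D) (r p)%:E <= (B / M k ^+ 2)%:E)%E.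
  rewrite EFinM muleC lee_pdivlMl ?exprn_gt0//; apply: le_trans wB.
  have -> : (M k ^+ 2 * M j / M k.+1)%:E = ((M k ^+ 2)%:E * (M j / M k.+1)%:E)%E.
    by rewrite -EFinM mulrA.
  rewrite -muleA lee_pmul2l ?lte_fin ?exprn_gt0//.
  rewrite -ge0_integralZl//; first last.
  - by move=> p _; rewrite lee_fin oscillation_ge0.
  - by apply: measurable_funTS; apply/measurable_EFinP.
  - exact: measurable_shifted_carrier.
  rewrite [leLHS]integral_mkcond [leRHS]integral_mkcond le_eqVlt; apply/orP; left.
  apply/eqP; apply: congr1; apply/funext => p; rewrite !patchE.
  have [pA|pA] := boolP (p \in shifted_carrier _ _ _ _ _ _).
    move: pA; rewrite inE => /(shifted_antidiag _ _ _ qkj)[pD pd].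
    by rewrite mem_set// /r asboolT// mulr1 -EFinM mulrC.
  case: ifPn => //; rewrite inE => pD; rewrite /r asboolF ?mulr0// => pd.
  by move: pA; rewrite notin_setE; apply; apply/(shifted_antidiag _ _ _ qkj).
move=> /(cintegral_real gr r0)/andP[I0 IB].
rewrite !mulr_ge0 ?exprn_ge0//=.
apply: le_trans (ler_wpM2l _ IB) _; first by rewrite mulr_ge0 ?exprn_ge0.
rewrite -!(rmorph_nat (real_complex R)) -rmorphXn -!rmorphM lecR le_eqVlt.
by apply/orP; left; apply/eqP; field; rewrite !gt_eqF.
Qed.

Lemma triple_sum_le (C J j : nat) (X : nat -> nat -> nat -> R[i]) (b : nat -> R) :
  (forall k, (m k <= C)%N) -> (J <= j.+1)%N -> (forall q, 0 <= b q) ->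
  (forall q k a, (q <= k < J)%N -> (a < m q)%N -> 0 <= X q k a <= (b q)%:C) ->
  0 <= \sum_(0 <= q < J) \sum_(q <= k < J) \sum_(1 <= a < m q) X q k a <=
    (\sum_(0 <= q < j.+1) (j.+1 - q)%:R * C%:R * b q)%:C.
Proof.
move=> mC Jj b0 Xb; apply/andP; split.
  rewrite big_nat_cond; apply: sumr_ge0 => q /andP[/andP[_ qJ] _].
  rewrite big_nat_cond; apply: sumr_ge0 => k /andP[qk _].
  rewrite big_nat_cond; apply: sumr_ge0 => a /andP[/andP[_ am] _].
  by have /andP[] := Xb q k a qk am.
apply: (@le_trans _ _ (\sum_(0 <= q < J) (((j.+1 - q)%:R * C%:R * b q)%:C))).
  apply: ler_sum_nat => q /andP[_ qJ].
  apply: (@le_trans _ _ (\sum_(q <= k < J) (C%:R * b q)%:C)).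
    apply: ler_sum_nat => k qk.
    apply: (@le_trans _ _ (\sum_(1 <= a < m q) (b q)%:C)).
      apply: ler_sum_nat => a /andP[_ am].
      by have /andP[] := Xb q k a qk am.
    rewrite sumr_const_nat -rmorphMn lecR -mulr_natl ler_wpM2r// ler_nat.
    by rewrite (leq_trans (leq_subr _ _)).
  rewrite sumr_const_nat -rmorphMn lecR -mulr_natl mulrA ler_wpM2r//.
  by rewrite ler_wpM2r// ler_nat leq_sub2r.
rewrite -rmorph_sum lecR (big_cat_nat (leq0n J) Jj)//= lerDl.
by apply: sumr_ge0 => q _; rewrite !mulr_ge0.
Qed.

(** Each of the four sums of W has at most (j + 1 - q) C summands for a given q:
j + 1 - q values of k and less than C values of a. *)
Lemma W_le (C j : nat) (z : T) (B : nat -> R) : (forall k, (m k <= C)%N) ->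
  (forall q, 0 <= B q) ->
  (forall s b q k a, (q <= k <= j)%N -> (a < C)%N ->
     (osc_mean s b q k a j z <= (B q)%:E)%E) ->
  0 <= W mu f j z <=
    (4 * \sum_(0 <= q < j.+1) (j.+1 - q)%:R * C%:R * (M q / M j * B q))%:C.
Proof.
move=> mC B0 oB; set S := \sum_(0 <= q < _) _.
have Mj0 n : 0 < M n by rewrite ltr0n radix_gt0.
have aC q a : (a < m q)%N -> (a < C)%N by move/leq_trans; apply.
have rect b : 0 <= \sum_(0 <= s < j.+1) \sum_(s <= i < j.+1)
      (radix m s)%:R * (radix m i)%:R * \sum_(1 <= a < m s)
      cintegral P (if b then cylinder j (0 : G) `*` cylinder i (single m s a)
        else cylinder i (single m s a) `*` cylinder j (0 : G)) (increment f z)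
    <= S%:C.
  under eq_bigr => s _ do under eq_bigr => i _ do rewrite mulr_sumr.
  apply: triple_sum_le => //.
    by move=> q; rewrite mulr_ge0// divr_ge0.
  by move=> q k a qk am; apply: rectangle_term => //; apply: oB => //; exact: aC am.
have diag b : 0 <= (radix m j)%:R^-1 * (\sum_(0 <= q < j) \sum_(q <= k < j) \sum_(1 <= a < m q)
    (radix m q)%:R * (radix m k)%:R ^+ 2 *
    cintegral P (if b then cylinder k (0 : G) `*` cylinder k (single m q a)
                 else cylinder k (single m q a) `*` cylinder k (0 : G))
     (fun p => increment f z p * rprod R k.+1 j.-1 p)) <= S%:C.
  have : 0 <= \sum_(0 <= q < j) \sum_(q <= k < j) \sum_(1 <= a < m q)
    (radix m q)%:R * (radix m k)%:R ^+ 2 *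
    cintegral P (if b then cylinder k (0 : G) `*` cylinder k (single m q a)
                 else cylinder k (single m q a) `*` cylinder k (0 : G))
     (fun p => increment f z p * rprod R k.+1 j.-1 p) <=
     (\sum_(0 <= q < j.+1) (j.+1 - q)%:R * C%:R * (M q * B q))%:C.
    apply: triple_sum_le => // [q|q k a qk am]; first by rewrite mulr_ge0.
    apply: antidiag_term => //; apply: oB; last exact: aC am.
    by case/andP: qk => -> /ltnW.
  move=> /andP[s0 sB]; rewrite mulr_ge0 ?invr_ge0//=.
  apply: le_trans (ler_wpM2l _ sB) _; first by rewrite invr_ge0.
  rewrite -(rmorph_nat (real_complex R)) -fmorphV -rmorphM lecR mulr_sumr.
  apply: ler_sum => q _; rewrite le_eqVlt; apply/orP; left; apply/eqP.
  by field; rewrite gt_eqF.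
have /andP[d1 D1] := diag true; have /andP[d2 D2] := diag false.
have /andP[e1 E1] := rect true; have /andP[e2 E2] := rect false.
rewrite /W; apply/andP; split; first by rewrite !addr_ge0.
have -> : (4 * S)%:C = S%:C + S%:C + S%:C + S%:C.
  by rewrite -!rmorphD; congr (_%:C); ring.
by apply: lerD E2; apply: lerD E1; exact: lerD.
Qed.

End bound_of_W.

(** * The exceptional set *)

Section series.
Variable R : realType.

(** The base 9/8 is small enough to be absorbed twice by 2/3 and once by 3/4:
(9/8)^2 (2/3) = (9/8) (3/4) = 27/32 < 1. *)
Lemma succ_le_exp n : (n.+1)%:R <= 8 * (9 / 8) ^+ n :> R.
Proof.
elim: n => [|n IH]; first by rewrite expr0; lra.
have e1 : 1 <= (9 / 8) ^+ n :> R by apply: exprn_ege1; lra.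
rewrite -natr1 exprS; lra.
Qed.

Lemma succ_geometric n : (n.+1)%:R * (3 / 4) ^+ n <= 8 * (27 / 32) ^+ n :> R.
Proof.
have -> : 27 / 32 = 9 / 8 * (3 / 4) :> R by field.
by rewrite [(_ * (3 / 4)) ^+ n]exprMn [leRHS]mulrA ler_wpM2r ?exprn_ge0 ?succ_le_exp//; lra.
Qed.

Lemma succ2_geometric n :
  (n.+1)%:R ^+ 2 * (2 / 3) ^+ n <= 64 * (27 / 32) ^+ n :> R.
Proof.
have -> : 27 / 32 = (9 / 8) ^+ 2 * (2 / 3) :> R by field.
rewrite [(_ * (2 / 3)) ^+ n]exprMn [leRHS]mulrA ler_wpM2r ?exprn_ge0//.
rewrite exprAC (_ : 64 = 8 ^+ 2); last by ring.
by rewrite -exprMn lerXn2r ?nnegrE ?succ_le_exp// mulr_ge0// exprn_ge0//; lra.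
Qed.

Lemma geometric_sum_le N : \sum_(0 <= n < N) (27 / 32) ^+ n <= 32 / 5 :> R.
Proof.
suff -> : \sum_(0 <= n < N) (27 / 32) ^+ n = 32 / 5 * (1 - (27 / 32) ^+ N) :> R.
  by have : 0 <= (27 / 32) ^+ N :> R by [rewrite exprn_ge0//; lra]; lra.
elim: N => [|N IH]; first by rewrite big_nil expr0; lra.
by rewrite big_nat_recr//= IH exprS; lra.
Qed.

End series.

Section Markov.
Context d (T : measurableType d) (R : realType) (P : probability T R).

Lemma markov_le (h : T -> R) (lam e : R) : measurable_fun setT h ->
  (forall z, 0 <= h z) -> 0 < lam -> (\int[P]_z (h z)%:E <= e%:E)%E ->
  (P [set z | lam < h z]%R <= (e / lam)%:E)%E.
Proof.
move=> mh h0 lam0 he; set E := [set z | _].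
have mhE : measurable_fun setT (EFin \o h) by exact/measurable_EFinP.
have mE : measurable E.
  rewrite (_ : E = [set z | (lam%:E < (EFin \o h) z)%E]).
    by rewrite -[X in measurable X]setTI; exact: emeasurable_fun_o_infty.
  by apply/seteqP; split => z; rewrite /E /= lte_fin.
rewrite EFinM muleC lee_pdivlMl// -integral_cst//.
apply: le_trans he.
apply: (@le_trans _ _ (\int[P]_(z in E) (h z)%:E)%E).
  apply: ge0_le_integral => //.
  - by move=> z _; rewrite lee_fin ltW.
  - exact: measurable_funTS.
  - by move=> z /ltW; rewrite lee_fin.
apply: ge0_subset_integral => //.
by move=> z _; rewrite lee_fin.
Qed.

Lemma measure_bigsetU_le (I : finType) (A : I -> set T) (x : \bar R) :
  (forall i, measurable (A i)) -> (forall i, P (A i) <= x)%E ->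
  measurable (\big[setU/set0]_i A i) /\
  (P (\big[setU/set0]_i A i) <= \sum_(i : I) x)%E.
Proof.
move=> mA Ax; apply: (big_ind2 (fun A s => measurable A /\ P A <= s)%E) => //=.
- by rewrite measure0.
- move=> A1 x1 A2 x2 [m1 A1x1] [m2 A2x2]; split; first exact: measurableU.
  by apply: le_trans (measureU2 _ _ _) _ => //; exact: leeD.
Qed.

Lemma measure_bigcup_le (A : nat -> set T) (x : nat -> R) (B : R) :
  (forall n, measurable (A n)) -> (forall n, P (A n) <= (x n)%:E)%E ->
  (forall N, \sum_(0 <= n < N) x n <= B) -> (P (\bigcup_n A n) <= B%:E)%E.
Proof.
move=> mA Ax xB.
apply: (@le_trans _ _ (\sum_(n <oo) P (A n))%E).
  by apply: measure_sigma_subadditive => //; exact: bigcup_measurable.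
apply: lime_le; first exact: is_cvg_nneseries.
apply: nearW => N; apply: (@le_trans _ _ (\sum_(0 <= n < N) (x n)%:E)%E).
  by apply: lee_sum => n _; exact: Ax.
by rewrite sumEFin lee_fin.
Qed.

End Markov.

Section exceptional_set.
Variables (R : realType) (m : nat -> nat).
Hypothesis m_ge2 : forall k, (2 <= m k)%N.
Local Notation G := (vilenkin m).
Local Notation T := (G * G)%type.
Variable mu : probability G R.
Hypothesis mu_haar : normalized_haar mu.
Local Notation P := (mu \x mu)%E.
Local Notation M n := ((radix m n)%:R : R).
Variable C : nat.
Hypothesis mC : forall k, (m k <= C)%N.

(* The maximal functions of spread n: the flags s and b, the level k = j - d with
   d <= n, and the multiple a of e_q. *)
Let cfg n : finType := (bool * bool * ('I_n.+1 * 'I_C))%type.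

Definition large_mean (h : T -> R) (lam : R) n (c : cfg n) : set T :=
  \bigcup_j large_convol P (EFin \o h)
    (shifted_carrier n c.2.1 c.1.1 c.1.2 c.2.2 j) (weight R m c.1.1 (j - c.2.1) j)
    (lam * (3 / 2) ^+ n).

(** The threshold grows like (3/2)^n with the spread n.  This is slower than 2^n,
so the weights 2 ^ - n keep W small off this set, and fast enough for the
measures of the level sets of all the maximal functions to be summable. *)
Definition exceptional (h : T -> R) (lam : R) : set T :=
  [set z | lam < h z] `|` \bigcup_n \big[setU/set0]_(c : cfg n) large_mean h lam c.

Variables (h : T -> R) (lam e : R).
Hypotheses (mh : measurable_fun setT h) (h0 : forall z, 0 <= h z).
Hypotheses (lam0 : 0 < lam) (he : (\int[P]_z (h z)%:E <= e%:E)%E).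

Let mhE : measurable_fun setT (EFin \o h).
Proof. exact/measurable_EFinP. Qed.

Let h0E z : (0 <= (EFin \o h) z)%E.
Proof. by rewrite lee_fin. Qed.

Let measurable_large_mean n (c : cfg n) : measurable (large_mean h lam c).
Proof.
apply: bigcup_measurable => j _; apply: measurable_large_convol => //.
exact: measurable_shifted_carrier.
Qed.

Let measure_large_mean n (c : cfg n) :
  (P (large_mean h lam c) <= (2 * (n.+1)%:R * e / lam * (2 / 3) ^+ n)%:E)%E.
Proof.
have r0 : 0 < lam * (3 / 2) ^+ n by rewrite mulr_gt0// exprn_gt0//; lra.
have := weak_type_kernel m_ge2 mu_haar c.1.1 c.1.2 c.2.2 (leq_ord c.2.1) mhE h0E (ltW r0).
rewrite -/(large_mean h lam c) => wt.
have {}wt : (P (large_mean h lam c) <=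
    (lam * (3 / 2) ^+ n)^-1%:E * ((2 * n.+1)%:R * e)%:E)%E.
  rewrite lee_pdivlMl//; apply: le_trans wt _.
  by rewrite EFinM lee_wpmul2l// lee_fin.
apply: le_trans wt _; rewrite -EFinM lee_fin le_eqVlt; apply/orP; left; apply/eqP.
have -> : (2 / 3) ^+ n = ((3 / 2) ^+ n)^-1 :> R by rewrite -exprVn invf_div.
have : (3 / 2) ^+ n != 0 :> R by rewrite expf_neq0//; lra.
by move=> e0; rewrite natrM; field; rewrite e0 gt_eqF.
Qed.

Lemma measurable_exceptional : measurable (exceptional h lam).
Proof.
apply: measurableU.
  rewrite (_ : [set z | _] = [set z | (lam%:E < (EFin \o h) z)%E]).
    by rewrite -[X in measurable X]setTI; exact: emeasurable_fun_o_infty.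
  by apply/seteqP; split => z; rewrite /= lte_fin.
apply: bigcup_measurable => n _; apply: bigsetU_measurable => c _.
exact: measurable_large_mean.
Qed.

(** There are 4 C (n + 1) maximal functions of spread n, each of weak type with
constant 2 (n + 1); hence the sum of 8 C (n + 1)^2 (2/3)^n. *)
Lemma measure_exceptional :
  (P (exceptional h lam) <= (e / lam + 8 * C%:R * (e / lam) * 64 * 8)%:E)%E.
Proof.
have e0 : 0 <= e.
  by rewrite -lee_fin (le_trans _ he)// integral_ge0// => z _; exact: h0E.
have mU n : measurable (\big[setU/set0]_(c : cfg n) large_mean h lam c).
  by apply: bigsetU_measurable.
have el0 : 0 <= e / lam by rewrite divr_ge0// ltW.
pose K := 8 * C%:R * (e / lam).
have K0 : 0 <= K by rewrite mulr_ge0// mulr_ge0.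
rewrite -/K EFinD; apply: le_trans (measureU2 _ _ _) _.
- rewrite (_ : [set z | _] = [set z | (lam%:E < (EFin \o h) z)%E]).
    by rewrite -[X in measurable X]setTI; exact: emeasurable_fun_o_infty.
  by apply/seteqP; split => z; rewrite /= lte_fin.
- exact: bigcup_measurable.
apply: leeD; first exact: markov_le.
apply: (measure_bigcup_le (x := fun n => K * 64 * (27 / 32) ^+ n)) => //.
  move=> n; have [_] := measure_bigsetU_le (@measurable_large_mean n) (@measure_large_mean n).
  move=> /le_trans; apply.
  rewrite sumEFin lee_fin sumr_const.
  have -> : #|(xpredT : pred (cfg n))| = (4 * (n.+1 * C))%N.
    by rewrite !card_prod !card_bool !card_ord.
  rewrite -[leLHS]mulr_natl !natrM -[leRHS]mulrA.
  apply: le_trans (ler_wpM2l K0 (succ2_geometric R n)).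
  rewrite le_eqVlt; apply/orP; left; apply/eqP; rewrite /K.
  by move: ((2 / 3) ^+ n) (n.+1%:R : R) (C%:R : R) => t u v; rewrite -[2 * u * e / lam]mulrA; ring.
move=> N; rewrite -mulr_sumr; apply: ler_wpM2l; first by rewrite mulr_ge0.
by apply: le_trans (geometric_sum_le R N) _; lra.
Qed.

Lemma notin_exceptional z : ~ exceptional h lam z ->
  h z <= lam /\ forall s b q k a j, (q <= k <= j)%N -> (a < C)%N ->
  ((weight R m s k j)%:E *
     convol P (shifted_carrier (j - q) (j - k) s b a j) (EFin \o h) z <=
   (lam * (3 / 2) ^+ (j - q))%:E)%E.
Proof.
move=> /not_orP[hz nz]; split; first by rewrite leNgt; apply/negP.
move=> s b q k a j /andP[qk kj] aC; rewrite leNgt; apply/negP => lt; apply: nz.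
have dn : (j - k < (j - q).+1)%N by rewrite ltnS leq_sub2l.
exists (j - q)%N => //; rewrite -bigcup_seq /=.
exists (s, b, (Ordinal dn, Ordinal aC)); first by rewrite /= mem_index_enum.
by exists j => //; rewrite /large_convol /= subKn.
Qed.

End exceptional_set.

(** * W off the exceptional set *)

Section final.
Variables (R : realType) (m : nat -> nat).
Hypothesis m_ge2 : forall k, (2 <= m k)%N.
Local Notation G := (vilenkin m).
Local Notation T := (G * G)%type.
Variable mu : probability G R.
Hypothesis mu_haar : normalized_haar mu.
Local Notation P := (mu \x mu)%E.
Local Notation M n := ((radix m n)%:R : R).
Variable C : nat.
Hypothesis mC : forall k, (m k <= C)%N.

(** Since weight times measure is at most 1, a constant added to h costs no more
than itself. *)
Lemma weighted_mean_le (A : set T) (w L c : R) (r h : T -> R) (z : T) :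
  measurable A -> measurable_fun setT r -> (forall p, 0 <= r p) ->
  measurable_fun setT h -> (forall p, 0 <= h p) ->
  (forall p, A p -> r p <= h (z - p) + c) -> 0 <= c -> 0 <= w ->
  (w%:E * P A <= 1)%E -> (w%:E * convol P A (EFin \o h) z <= L%:E)%E ->
  (w%:E * \int[P]_(p in A) (r p)%:E <= (L + c)%:E)%E.
Proof.
move=> mA mr r0 mh h0 rh c0 w0 wA wL.
have mhz : measurable_fun A (fun p : T => (EFin \o h) (z - p)%R).
  by apply: measurable_funTS; apply: measurable_sub_comp; exact/measurable_EFinP.
apply: (@le_trans _ _ (w%:E * \int[P]_(p in A) ((EFin \o h) (z - p)%R + c%:E))%E).
  apply: lee_wpmul2l; first by rewrite lee_fin.
  apply: ge0_le_integral => //.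
  - by move=> p _; rewrite lee_fin.
  - by apply: measurable_funTS; exact/measurable_EFinP.
  - by apply: emeasurable_funD => //; exact: measurable_cst.
rewrite ge0_integralD//; last by move=> p _; rewrite lee_fin.
rewrite integral_cst// ge0_muleDr; first last.
- by rewrite mule_ge0.
- by apply: integral_ge0 => p _; rewrite lee_fin.
rewrite EFinD; apply: leeD => //.
by rewrite muleCA -[leRHS]mule1; apply: lee_wpmul2l.
Qed.

Lemma radix_ratio q j : (q <= j)%N -> M q / M j <= 2^-1 ^+ (j - q).
Proof.
have M0 n : 0 < M n by rewrite ltr0n radix_gt0.
move=> /subnK <-; rewrite addnK; elim: (j - q)%N => [|n IH].
  by rewrite add0n divff ?gt_eqF// expr0.
rewrite addSn radixS natrM invfM mulrA exprS mulrC.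
apply: ler_pM => //.
by rewrite lef_pV2 ?posrE// ?ltr0n ?(ltnW (m_ge2 _))// ler_nat.
Qed.

Variables (f : T -> R[i]) (h : T -> R) (S lam : R) (N : nat).
Hypotheses (mosc : forall z, measurable_fun setT (oscillation f z)).
Hypotheses (mh : measurable_fun setT h) (h0 : forall z, 0 <= h z).
Hypotheses (S0 : 0 <= S) (lam0 : 0 < lam).
Hypothesis osc_h : forall z p,
  oscillation f z p <= h (z - p) + h z + (if `[< square N p >] then 0 else S).

(** Off the exceptional set a mean of spread n = j - q is at most
lam (3/2)^n + lam, plus S if q < N.  Against the weights
(n + 1) 2 ^ - n the first part sums to a multiple of lam, uniformly in j, while
the second part only involves the N lowest levels q and tends to 0 with j. *)
Lemma W_exceptional z j : ~ exceptional mu C h lam z -> (N <= j)%N ->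
  0 <= W mu f j z <=
    (32 * C%:R * (16 * lam + N%:R * S * (27 / 32) ^+ (j - N)))%:C%C.
Proof.
move=> /(notin_exceptional)[hz wz] Nj.
pose B q := lam * (3 / 2) ^+ (j - q) + (h z + (if (N <= q)%N then 0 else S)).
have c0 q : 0 <= h z + (if (N <= q)%N then 0 else S).
  by rewrite addr_ge0//; case: ifP.
have B0 q : 0 <= B q.
  by rewrite /B addr_ge0// mulr_ge0 ?(ltW lam0)// exprn_ge0//; lra.
have /andP[W0 WB] : 0 <= W mu f j z <=
    (4 * \sum_(0 <= q < j.+1) (j.+1 - q)%:R * C%:R * (M q / M j * B q))%:C%C.
  apply: W_le => // s b q k a qkj aC; rewrite /osc_mean /B.
  have dn : (j - k <= j - q)%N by rewrite leq_sub2l//; case/andP: qkj.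
  have kj : (k <= j)%N by case/andP: qkj.
  have qj : (q <= j)%N by apply: leq_trans kj; case/andP: qkj.
  apply: (weighted_mean_le (h := h) (z := z)) => //.
  - exact: measurable_shifted_carrier.
  - exact: oscillation_ge0.
  - move=> p /(shifted_carrier_square dn); rewrite subKn// => pq.
    apply: le_trans (osc_h z p) _; rewrite -addrA. rewrite !lerD2l.
    case: (leqP N q) => Nq; first by rewrite asboolT//; exact: (square_le Nq).
    by case: ifP.
  - exact: weight_ge0.
  - have := weight_shifted_carrier m_ge2 mu_haar (j - q) (j - k) s b a j.
    by rewrite subKn.
  - exact: wz.
rewrite W0; apply: le_trans WB _; rewrite lecR.
pose th : R := 27 / 32.
have th0 : 0 <= th by rewrite /th; lra.
have th1 : th <= 1 by rewrite /th; lra.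
have Bq q : (q <= j)%N ->
    (j.+1 - q)%:R * C%:R * (M q / M j * B q) <=
    C%:R * (8 * th ^+ (j - q) * (2 * lam) + (if (N <= q)%N then 0 else 8 * th ^+ (j - N) * S)).
  move=> qj; rewrite subSn// [_ * C%:R]mulrC -[leLHS]mulrA ler_wpM2l//.
  set n := (j - q)%N; pose a : R := n.+1%:R * 2^-1 ^+ n.
  have e1 : 1 <= (3 / 2) ^+ n :> R by apply: exprn_ege1; lra.
  have a0 : 0 <= a by rewrite mulr_ge0// exprn_ge0.
  have ab : a * (3 / 2) ^+ n <= 8 * th ^+ n.
    rewrite /a -mulrA -exprMn (_ : 2^-1 * (3 / 2) = 3 / 4 :> R); last by field.
    exact: succ_geometric.
  have aa : a <= 8 * th ^+ n by apply: le_trans ab; rewrite ler_peMr.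
  apply: (@le_trans _ _ (a * B q)).
    rewrite /a -[leRHS]mulrA ler_wpM2l// ler_wpM2r//; exact: radix_ratio.
  apply: (@le_trans _ _ (a * (3 / 2) ^+ n * (2 * lam) +
      a * (if (N <= q)%N then 0 else S))).
    rewrite /B -/n addrA mulrDr lerD2r -[leRHS]mulrA ler_wpM2l//.
    have : lam <= (3 / 2) ^+ n * lam by rewrite ler_peMl// ltW.
    lra.
  apply: lerD; first by rewrite ler_wpM2r// mulr_ge0// ltW.
  case: leqP => Nq; first by rewrite mulr0.
  rewrite ler_wpM2r//; apply: le_trans aa _; rewrite ler_wpM2l//.
  by apply: ler_wiXn2l => //; rewrite /n leq_sub2l// ltnW.
apply: (@le_trans _ _ (4 * \sum_(0 <= q < j.+1)
   (C%:R * (8 * th ^+ (j - q) * (2 * lam) + (if (N <= q)%N then 0 else 8 * th ^+ (j - N) * S))))).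
  by rewrite ler_wpM2l//; apply: ler_sum_nat => q /andP[_ qj]; exact: Bq.
rewrite -mulr_sumr big_split/= -mulr_suml -mulr_sumr.
have gs : \sum_(0 <= q < j.+1) th ^+ (j - q) <= 8.
  rewrite big_nat_rev/= add0n.
  under eq_big_nat => q /andP[_ qj] do rewrite subSS subKn//.
  by apply: le_trans (geometric_sum_le R _) _; lra.
have ts : \sum_(0 <= q < j.+1) (if (N <= q)%N then 0 else 8 * th ^+ (j - N) * S) =
    N%:R * (8 * th ^+ (j - N) * S).
  rewrite (big_cat_nat (leq0n N) (leqW Nj))/=.
  under eq_big_nat => q /andP[_ qN] do rewrite leqNgt qN /=.
  under [X in _ + X]eq_big_nat => q /andP[Nq _] do rewrite Nq.
  by rewrite big1_eq addr0 sumr_const_nat subn0 [RHS]mulr_natl.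
rewrite ts -/th.
apply: (@le_trans _ _ (4 * (C%:R * (8 * 8 * (2 * lam) + N%:R * (8 * th ^+ (j - N) * S))))).
  rewrite ler_wpM2l// ler_wpM2l// lerD2r ler_wpM2r ?mulr_ge0 ?(ltW lam0)//.
  by rewrite ler_wpM2l.
by rewrite le_eqVlt; apply/orP; left; apply/eqP; ring.
Qed.

End final.

(** * Almost everywhere convergence *)

Lemma geometric_small (R : realType) (a e t : R) : 0 <= t < 1 -> 0 < e ->
  exists n0, forall n, (n0 <= n)%N -> a * t ^+ n < e.
Proof.
move=> /andP[t0 t1] e0; have : `|t| < 1 by rewrite ger0_norm.
move=> /(cvg_geometric a) /cvgr0Pnorm_lt /(_ e e0) [n0 _ h].
by exists n0 => n /h /=; apply: le_lt_trans; exact: ler_norm.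
Qed.

Section decomposition.
Variables (R : realType) (m : nat -> nat).
Local Notation G := (vilenkin m).
Local Notation T := (G * G)%type.
Variables (P : probability T R) (f : T -> R[i]).
Hypothesis f_L1 : cintegrable P f.
Local Open Scope complex_scope.

Lemma normc_le (x : R[i]) : complex.Re `|x| <= `|complex.Re x| + `|complex.Im x|.
Proof.
rewrite normc_def /=.
have s0 : 0 <= `|complex.Re x| + `|complex.Im x| by rewrite addr_ge0.
rewrite -(@ler_pXn2r _ 2) ?nnegrE ?sqrtr_ge0// sqr_sqrtr ?addr_ge0 ?sqr_ge0//.
rewrite -(real_normK (num_real (complex.Re x))) -(real_normK (num_real (complex.Im x))).
by rewrite sqrrD addrAC lerDl mulrn_wge0// mulr_ge0.
Qed.

Lemma measurable_oscillation z : measurable_fun setT (oscillation f z).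
Proof.
have [/measurable_int/measurable_EFinP mRe /measurable_int/measurable_EFinP mIm] := f_L1.
have msub : measurable_fun setT (fun p : T => z - p) by exact: measurable_fun_subT.
have mD (g : T -> R) : measurable_fun setT g ->
    measurable_fun setT (fun p : T => (g (z - p) - g z) ^+ 2).
  move=> mg; apply: measurable_funX; apply: measurable_funB => //.
  exact: (measurableT_comp mg).
rewrite (_ : oscillation f z = fun p => Num.sqrt
  ((complex.Re (f (z - p)) - complex.Re (f z)) ^+ 2 +
   (complex.Im (f (z - p)) - complex.Im (f z)) ^+ 2)); last first.
  apply/funext => p; rewrite /oscillation /increment normc_def /=.
  by change (z.1 - p.1, z.2 - p.2) with (z - p); case: (f (z - p)) (f z) => [a b] [c d].
have msqrt : measurable_fun setT (@Num.sqrt R).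
  by apply: continuous_measurable_fun; exact: sqrt_continuous.
apply: (measurableT_comp msqrt).
by apply: measurable_funD; [exact: (mD _ mRe)|exact: (mD _ mIm)].
Qed.

(** Replace f by a function of finitely many coordinates, close in L1: h is the
size of the error, and the oscillation of the approximant vanishes for
increments in the square of order N. *)
Lemma oscillation_decomposition (e : R) : 0 < e ->
  exists hSN : (T -> R) * R * nat,
  let: (h, B, N) := hSN in
  [/\ measurable_fun setT h, forall z, 0 <= h z,
      0 <= B, (\int[P]_z (h z)%:E <= e%:E)%E &
      forall z p, oscillation f z p <=
        h (z - p) + h z + (if `[< square N p >] then 0 else B)].
Proof.
move=> e0; have e20 : 0 < e / 2 by rewrite divr_gt0.
have [iRe iIm] := f_L1.
have mRe := (measurable_EFinP _ _).1 (measurable_int _ iRe).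
have mIm := (measurable_EFinP _ _).1 (measurable_int _ iIm).
have [N [g [S [mg cg gS ug]]]] := integrable_cylinder_approx iRe e20.
have [N' [g' [S' [mg' cg' gS' ug']]]] := integrable_cylinder_approx iIm e20.
pose h z := `|complex.Re (f z) - g z| + `|complex.Im (f z) - g' z|.
have mh1 : measurable_fun setT (fun z => `|complex.Re (f z) - g z|).
  by apply: measurableT_comp => //; exact: measurable_funB.
have mh2 : measurable_fun setT (fun z => `|complex.Im (f z) - g' z|).
  by apply: measurableT_comp => //; exact: measurable_funB.
exists (h, 2 * (S + S'), maxn N N'); split.
- exact: measurable_funD.
- by move=> z; rewrite /h addr_ge0.
- by rewrite mulr_ge0// addr_ge0// (le_trans (normr_ge0 _) (gS 0), le_trans (normr_ge0 _) (gS' 0)).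
- rewrite [e]splitr EFinD /h; under eq_integral do rewrite EFinD.
  rewrite ge0_integralD//; first exact: leeD.
  + exact/measurable_EFinP.
  + exact/measurable_EFinP.
move=> z p; rewrite /oscillation.
apply: le_trans (normc_le _) _.
set a := complex.Re _; set b := complex.Im _.
have -> : a = (complex.Re (f (z - p)) - g (z - p)) - (complex.Re (f z) - g z) + (g (z - p) - g z).
  rewrite /a; change (z.1 - p.1, z.2 - p.2) with (z - p).
  by case: (f (z - p)) (f z) => [? ?] [? ?] /=; ring.
have -> : b = (complex.Im (f (z - p)) - g' (z - p)) - (complex.Im (f z) - g' z) + (g' (z - p) - g' z).
  rewrite /b; change (z.1 - p.1, z.2 - p.2) with (z - p).
  by case: (f (z - p)) (f z) => [? ?] [? ?] /=; ring.
set x := _ - g (z - p); set y := _ - g' (z - p); set x' := _ - g z; set y' := _ - g' z.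
have gg : `|g (z - p) - g z| + `|g' (z - p) - g' z| <=
    if `[< square (maxn N N') p >] then 0 else 2 * (S + S').
  case: asboolP => [pN|_].
    rewrite (cg _ _ (square_le (leq_maxl _ _) pN)) (cg' _ _ (square_le (leq_maxr _ _) pN)).
    by rewrite !subrr normr0 addr0.
  have := ler_normB (g (z - p)) (g z); have := ler_normB (g' (z - p)) (g' z).
  have := gS (z - p); have := gS z; have := gS' (z - p); have := gS' z; lra.
apply: le_trans (lerD (ler_normD _ _) (ler_normD _ _)) _.
have := ler_normB x x'; have := ler_normB y y'.
rewrite /h -/x -/x' -/y -/y'; move: gg; case: asboolP => _; lra.
Qed.

End decomposition.


Theorem corollary1 (R : realType) (m : nat -> nat)
    (m_ge2 : forall k, (2 <= m k)%N)
    (m_bounded : exists C : nat, forall k, (m k <= C)%N)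
    (mu : probability (vilenkin m) R) (mu_haar : normalized_haar mu)
    (f : vilenkin m * vilenkin m -> R[i])
    (f_L1 : cintegrable (mu \x mu)%E f) :
  {ae (mu \x mu)%E, forall z, marcinkiewicz_lebesgue_point mu f z}.
Proof.
have [C mC] := m_bounded.
have e0 k : 0 < (1 / 4) ^+ k :> R by rewrite exprn_gt0//; lra.
have [d dP] := choice (fun k => oscillation_decomposition (P := (mu \x mu)%E) f_L1 (e0 k)).
pose h k := (d k).1.1; pose S k := (d k).1.2; pose N k := (d k).2.
have {dP} dP k : [/\ measurable_fun setT (h k), forall z, 0 <= h k z,
      0 <= S k, (\int[mu \x mu]_z (h k z)%:E <= ((1 / 4) ^+ k)%:E)%E &
      forall z p, oscillation f z p <=
        h k (z - p) + h k z + (if `[< square (N k) p >] then 0 else S k)].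
  by have := dP k; rewrite /h /S /N; case: (d k) => -[].
(* An L1 error of 4 ^ - k against a level of 2 ^ - k leaves exceptional sets of
   measure O(2 ^ - k), to which the Borel-Cantelli lemma applies. *)
pose lam k : R := (1 / 2) ^+ k.
have lam0 k : 0 < lam k by rewrite exprn_gt0//; lra.
pose E k := exceptional mu C (h k) (lam k).
have mE k : measurable (E k) by have [mh h0 _ _ _] := dP k; exact: measurable_exceptional.
pose K : R := 1 + 8 * C%:R * 64 * 8.
have K0 : 0 <= K by rewrite addr_ge0// !mulr_ge0.
have PE k : ((mu \x mu) (E k) <= (K * lam k)%:E)%E.
  have [mh h0 _ he _] := dP k.
  apply: le_trans (measure_exceptional m_ge2 mu_haar C mh h0 (lam0 k) he) _.
  rewrite lee_fin le_eqVlt; apply/orP; left; apply/eqP.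
  have -> : (1 / 4) ^+ k / lam k = lam k.
    rewrite /lam (_ : 1 / 4 = 1 / 2 * (1 / 2) :> R); last by field.
    by rewrite exprMn mulfK// gt_eqF// lam0.
  by rewrite /K; ring.
have E0 : (mu \x mu)%E (lim_sup_set E) = 0.
  apply: lim_sup_set_cvg0 => //; apply: (@le_lt_trans _ _ (K * 2)%:E); last exact: ltry.
  apply: lime_le; first exact: is_cvg_nneseries.
  apply: nearW => n; apply: (@le_trans _ _ (\sum_(0 <= k < n) (K * lam k)%:E)%E).
    by apply: lee_sum => k _; exact: PE.
  rewrite sumEFin lee_fin -mulr_sumr ler_wpM2l//.
  suff -> : \sum_(0 <= k < n) lam k = 2 * (1 - lam n) by have := lam0 n; lra.
  elim: n => [|n IH]; first by rewrite big_nil /lam expr0 subrr mulr0.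
  by rewrite big_nat_recr//= IH /lam exprS; lra.
have mlim : measurable (lim_sup_set E).
  by apply: bigcap_measurable => // n _; exact: bigcup_measurable.
have : (mu \x mu)%E.-negligible (lim_sup_set E) by apply/negligibleP.
apply: negligibleS.
move=> z; apply: contra_notP => zE.
have [k0 k0E] : exists k0, forall k, (k0 <= k)%N -> ~ E k z.
  apply: contrapT => nk; apply: zE => n _.
  apply: contrapT => nU; apply: nk; exists n => k nk Ekz.
  by apply: nU; exists k.
rewrite /marcinkiewicz_lebesgue_point; apply/cvgr0Pnorm_lt => eps eps0.
have [er er0 ->] : exists2 er : R, 0 < er & eps = (er%:C)%C.
  move: eps0; rewrite ltcE => /andP[/eqP im re]; exists (complex.Re eps) => //.
  by apply/eqP; rewrite eq_complex /= im !eqxx.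
have er20 : 0 < er / 2 by rewrite divr_gt0.
have h12 : 0 <= (1 / 2 : R) < 1 by apply/andP; split; lra.
have h27 : 0 <= (27 / 32 : R) < 1 by apply/andP; split; lra.
(* First k, which fixes the approximant and its order N k, then the index j. *)
have [k1 k1P] := geometric_small (32 * C%:R * 16) h12 er20.
pose k := maxn k0 k1.
have [j0 j0P] := geometric_small (32 * C%:R * (N k)%:R * S k) h27 er20.
have [mh h0 S0 _ osc] := dP k.
exists (N k + j0)%N => // j /= jN.
have Nj : (N k <= j)%N by apply: leq_trans jN; exact: leq_addr.
have /andP[W0 WB] := W_exceptional m_ge2 mu_haar mC (measurable_oscillation f_L1) mh h0 S0
  (lam0 k) osc (k0E k (leq_maxl _ _)) Nj.
rewrite ger0_norm//; apply: le_lt_trans WB _; rewrite ltcR.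
have := k1P k (leq_maxr _ _).
have := j0P (j - N k)%N; rewrite leq_subRL// => /(_ jN).
rewrite -/(lam k); move: ((27 / 32) ^+ (j - N k)) => t h1 h2.
rewrite [X in X < _](_ : _ = 32 * C%:R * 16 * lam k + 32 * C%:R * (N k)%:R * S k * t).
  by rewrite [er]splitr; exact: ltrD.
by ring.
Qed.
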